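(* Let $\mathbf{F}$ be a continuous bundle random dynamical system over $(\Omega,\mathcal{F},\mathbb{P},G)$ with compact metric state space $X$, and let $\mathbf{D}=\{d_F:F\in\mathcal{F}_G\}\subseteq\mathbf{L}^1_{\mathcal{E}}(\Omega,C(X))$ be a sub-additive $G$-invariant family. If $G$ is abelian then for any sequence $\{\nu_n:n\in\mathbb{N}\}\subseteq\mathcal{P}_{\mathbb{P}}(\mathcal{E})$, setting $\mu_n=\frac{1}{|F_n|}\sum_{g\in F_n}g\nu_n$ for each $n\in\mathbb{N}$, there exists a subsequence $\{n_j:j\in\mathbb{N}\}\subseteq\mathbb{N}$ such that $\{\mu_{n_j}:j\in\mathbb{N}\}$ converges to some $\mu\in\mathcal{P}_{\mathbb{P}}(\mathcal{E})$ (and hence $\mu\in\mathcal{P}_{\mathbb{P}}(\mathcal{E},G)$) with $$\limsup_{j\to\infty}\frac{1}{|F_{n_j}|}\int_{\mathcal{E}}d_{F_{n_j}}(\omega,x)\,d\nu_{n_j}(\omega,x)\le\mu(\mathbf{D}).$$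
   Context: $G$ is an infinite countable discrete amenable group with identity $e_G$; $\mathcal{F}_G$ is the set of non-empty finite subsets of $G$; $\{F_n\}_{n\in\mathbb{N}}\subseteq\mathcal{F}_G$ is a fixed F\o lner sequence ($|gF_n\Delta F_n|/|F_n|\to0$ for every $g\in G$) with $e_G\in F_1\subsetneq F_2\subsetneq\cdots$, and each $F_n$ tiles $G$, i.e. there is $\emptyset\ne G_n\subseteq G$ such that $\{F_nc:c\in G_n\}$ is a partition of $G$. $(\Omega,\mathcal{F},\mathbb{P})$ is a Lebesgue (in particular complete) probability space on which $G$ acts by invertible measure-preserving transformations, $e_G$ acting as the identity. $X$ is a compact metric space with Borel $\sigma$-algebra $\mathcal{B}_X$, $\mathcal{E}\in\mathcal{F}\times\mathcal{B}_X$, $\mathcal{E}_\omega=\{x:(\omega,x)\in\mathcal{E}\}$. A continuous bundle random dynamical system over $(\Omega,\mathcal{F},\mathbb{P},G)$ is a family $\mathbf{F}=\{F_{g,\omega}:\mathcal{E}_\omega\to\mathcal{E}_{g\omega}\mid g\in G,\omega\in\Omega\}$ such that $F_{e_G,\omega}=\mathrm{id}$; $(\omega,x)\mapsto F_{g,\omega}(x)$ is measurable on $\mathcal{E}$ for each $g$; $F_{g_2,g_1\omega}\circ F_{g_1,\omega}=F_{g_2g_1,\omega}$ for all $\omega,g_1,g_2$; and for $\mathbb{P}$-a.e. $\omega$, $\mathcal{E}_\omega$ is non-empty compact and every $F_{g,\omega}$ is continuous. $G$ acts on $\mathcal{E}$ by $g(\omega,x)=(g\omega,F_{g,\omega}x)$.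 $\mathcal{P}_{\mathbb{P}}(\mathcal{E})$: probability measures $\mu$ on $\Omega\times X$ with marginal $\mathbb{P}$ on $\Omega$ and $\mu(\mathcal{E})=1$; $\mathcal{P}_{\mathbb{P}}(\mathcal{E},G)$: its $G$-invariant elements. $\mathbf{L}^1_{\mathcal{E}}(\Omega,C(X))$: real functions $f$ on $\mathcal{E}$, measurable in $(\omega,x)$, continuous in $x\in\mathcal{E}_\omega$ for fixed $\omega$, with $\int_\Omega\sup_{x\in\mathcal{E}_\omega}|f(\omega,x)|\,d\mathbb{P}(\omega)<\infty$ (functions at distance $0$ identified). Convergence $\mu_n\to\mu$ in $\mathcal{P}_{\mathbb{P}}(\mathcal{E})$ means $\int f\,d\mu_n\to\int f\,d\mu$ for all such $f$. $\mathbf{D}$ is *sub-additive* if for $\mathbb{P}$-a.e. $\omega$, $d_{E\cup Fg}(\omega,x)\le d_E(\omega,x)+d_F(g(\omega,x))$ whenever $E,F\in\mathcal{F}_G$, $g\in G$, $E\cap Fg=\emptyset$, $x\in\mathcal{E}_\omega$; it is *$G$-invariant* if for $\mathbb{P}$-a.e. $\omega$, $d_{Fg}(\omega,x)=d_F(g(\omega,x))$ for all $F\in\mathcal{F}_G$, $g\in G$, $x\in\mathcal{E}_\omega$. For such $\mathbf{D}$ and $\mu\in\mathcal{P}_{\mathbb{P}}(\mathcal{E},G)$, $\mu(\mathbf{D})=\lim_n\frac{1}{|F_n|}\int_{\mathcal{E}}d_{F_n}\,d\mu=\inf_n\frac{1}{|F_n|}\int_{\mathcal{E}}d_{F_n}\,d\mu\in[-\infty,\infty)$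 (the limit exists and equals the infimum because the $F_n$ tile $G$). *)

(* Defs.v *)
From HB Require Import structures.
From mathcomp Require Import all_boot all_order all_algebra finmap.
From mathcomp Require Import all_classical all_reals all_analysis.
From mathcomp Require Import measurable_realfun.

Set Implicit Arguments.
Unset Strict Implicit.
Unset Printing Implicit Defensive.
Import Order.TTheory GRing.Theory Num.Theory.
Import numFieldNormedType.Exports.

Local Open Scope classical_set_scope.
Local Open Scope ring_scope.

(* Measurable types are pointed in the library, hence the join. *)
#[short(type="pmetricType")]
HB.structure Definition PMetric (K : numDomainType) :=
  {M of Pointed M & Metric K M}.

Notation borel X := (g_sigma_algebraType (@open X)).

Section lebesgue_space.
Local Open Scope ereal_scope.
Context (R : realType) d (T : measurableType d) (P : probability T R).

(* Isomorphism modulo null sets with the completion of the Borel probability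
   measure m on the line. *)
Definition isomorphic_mod0 (m : probability (measurableTypeR R) R) : Prop :=
  exists (N : set T) (M : set (measurableTypeR R)) (phi : T -> R),
    [/\ measurable N /\ P N = 0,
        measurable M /\ m M = 1,
        set_bij (~` N) M phi,
        forall A, A `<=` ~` N ->
          (measurable A <-> completed_algebra_gen m (phi @` A)) &
        forall B, measurable B -> P (~` N `&` phi @^-1` B) = m B].

(* Lebesgue measure on [0, a] together with countably many atoms, the k-th of
   mass p k; the atoms are placed at the points -1, -2, ..., off [0, a]. *)
Definition interval_with_atoms (a : R) (p : nat -> R)
    (B : set (measurableTypeR R)) : \bar R :=
  lebesgue_measure (B `&` `[0%R, a]%classic) +
  \sum_(k <oo) (p k)%:E * \d_(- k.+1%:R : measurableTypeR R)%R B.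

Definition lebesgue_space : Prop :=
  measure_is_complete P /\
  exists (a : R) (p : nat -> R) (m : probability (measurableTypeR R) R),
    [/\ (0 <= a)%R, forall k, (0 <= p k)%R,
        forall B, measurable B -> m B = interval_with_atoms a p B &
        isomorphic_mod0 m].

End lebesgue_space.

Section folner.
Context (R : realType) (G : groupType).
Implicit Types (A : {fset G}) (g : G).

Definition ltranslate g A : {fset G} := [fset (g * h)%g | h in A]%fset.

Definition rtranslate A g : {fset G} := [fset (h * g)%g | h in A]%fset.

Definition symdiff A B : {fset G} := ((A `\` B) `|` (B `\` A))%fset.

Definition tiles A : Prop :=
  exists C : set G, C !=set0 /\
    partition C (fun c => [set` rtranslate A c]) [set: G].

Record folner_seq := FolnerSeq {
  folner_set :> nat -> {fset G} ;
  folner_cvg : forall g, (fun n =>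
    #|` symdiff (ltranslate g (folner_set n)) (folner_set n)|%:R /
    #|` folner_set n|%:R : R) @ \oo --> (0 : R) ;
  folner1 : (1%g : G) \in folner_set 0 ;
  folner_proper : forall n, (folner_set n `<` folner_set n.+1)%fset ;
  folner_tiles : forall n, tiles (folner_set n) }.

Lemma folner_neq0 (Fn : folner_seq) n : Fn n != fset0.
Proof.
suff : (1%g : G) \in Fn n by move=> h; apply/fset0Pn; exists 1%g.
elim: n => [|n ih]; first exact: folner1.
exact: (fsubsetP (fproper_sub (folner_proper Fn n))).
Qed.

End folner.

Section random_dynamics.
Context (R : realType) (G : groupType) d (Om : measurableType d).

Record mp_action (P : probability Om R) := MPAction {
  act :> G -> Om -> Om ;
  measurable_act : forall g, measurable_fun [set: Om] (act g) ;
  act_preserving : forall g A, measurable A -> P (act g @^-1` A) = P A ;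
  act1 : forall w, act 1%g w = w ;
  actM : forall g h w, act (g * h)%g w = act g (act h w) }.

(* The maps F_(g, w) : E_w -> E_(g w) are represented by total maps X -> X,
   only the restriction of which to the fibre E_w is constrained or used. *)
Record bundle_rds (P : probability Om R) (T : mp_action P)
    (X : pmetricType R) := BundleRDS {
  bundle : set (Om * borel X) ;
  fmap : G -> Om -> X -> X ;
  measurable_bundle : measurable bundle ;
  fmap_bundle : forall g w x,
    bundle (w, x) -> bundle (T g w, fmap g w x) ;
  fmap1 : forall w x, bundle (w, x) -> fmap 1%g w x = x ;
  measurable_fmap : forall g,
    measurable_fun bundle (fun z => fmap g z.1 z.2 : borel X) ;
  fmapM : forall g h w x, bundle (w, x) ->
    fmap g (T h w) (fmap h w x) = fmap (g * h)%g w x ;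
  bundle_ae : {ae P, forall w,
    let Ew := [set x : X | bundle (w, x)] in
    [/\ Ew !=set0, compact Ew &
        forall g, {within Ew, continuous (fmap g w)}]} }.

Context (P : probability Om R) (T : mp_action P) (X : pmetricType R).
Variable F : bundle_rds T X.

Definition fibre (w : Om) : set X := [set x | bundle F (w, x)].

(* The action of G on the bundle, extended by the identity off the bundle. *)
Definition skew (g : G) : Om * borel X -> Om * borel X :=
  patch id (bundle F) (fun z => (T g z.1, fmap F g z.1 z.2)).

Lemma measurable_skew g : measurable_fun [set: Om * borel X] (skew g).
Proof.
have mE : measurable_fun [set: Om * borel X] (fun z => z \in bundle F).
  apply: (@measurable_fun_bool _ _ _ _ true).
  rewrite setTI (_ : _ @^-1` _ = bundle F); first exact: measurable_bundle.
  by apply/seteqP; split=> z; [exact: set_mem|exact: mem_set].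
apply/measurable_fun_pairP; split.
  have -> : fst \o skew g = fun z => if z \in bundle F then T g z.1 else z.1.
    by apply/funext => z; rewrite /skew /patch /=; case: ifP.
  apply: measurable_fun_ifT => //.
  by apply: measurableT_comp => //; exact: measurable_act.
have -> : snd \o skew g =
    fun z => if z \in bundle F then fmap F g z.1 z.2 : borel X else z.2.
  by apply/funext => z; rewrite /skew /patch /=; case: ifP.
apply: measurable_fun_if => //.
  rewrite setTI (_ : _ @^-1` _ = bundle F); first exact: measurable_fmap.
  by apply/seteqP; split=> z; [exact: set_mem|exact: mem_set].
by apply: measurable_funS measurable_snd.
Qed.

Section act_prob.
Context (g : G) (nu : probability (Om * borel X)%type R).

(* The measure g nu. *)
Definition act_prob : set (Om * borel X) -> \bar R := pushforward nu (skew g).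

HB.instance Definition _ := Measure.copy act_prob
  (measure_function_pushforward__canonical__measure_function_Measure nu
     (measurable_skew g)).

Let act_prob_setT : act_prob setT = 1%E.
Proof. by rewrite /act_prob /pushforward preimage_setT probability_setT. Qed.

HB.instance Definition _ :=
  Measure_isProbability.Build _ _ _ act_prob act_prob_setT.

End act_prob.

Section average.
Local Open Scope ereal_scope.
Context (A : {fset G}) (nu : probability (Om * borel X)%type R).

(* The proof A0 is an argument for the sake of the probability instance. *)
Definition average (A0 : A != fset0) (B : set (Om * borel X)) : \bar R :=
  (#|` A|%:R^-1 : R)%:E * \sum_(g <- A) act_prob g nu B.

Hypothesis A0 : A != fset0.

Let averageE : average A0 =
  mscale ((#|` A|%:R^-1 : R)%:nng)%R
    (msum (fun k => act_prob (nth 1%g A k) nu) #|` A|).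
Proof.
apply/funext => B; rewrite /average /mscale /msum /=.
by rewrite (big_nth 1%g) big_mkord.
Qed.

Let average0 : average A0 set0 = 0.
Proof. by rewrite averageE measure0. Qed.

Let average_ge0 B : 0 <= average A0 B.
Proof. by rewrite averageE. Qed.

Let average_sigma_additive : semi_sigma_additive (average A0).
Proof. by rewrite averageE; exact: measure_semi_sigma_additive. Qed.

HB.instance Definition _ := isMeasure.Build _ _ _ (average A0)
  average0 average_ge0 average_sigma_additive.

Let average_setT : average A0 setT = 1.
Proof.
have A1 : (#|` A|%:R != 0 :> R)%R by rewrite pnatr_eq0 cardfs_eq0.
rewrite /average (eq_bigr (fun=> 1%:E)) => [|g _]; last first.
  by rewrite /= probability_setT.
by rewrite sumEFin big_const_seq count_predT iter_addr_0 -EFinM mulVf.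
Qed.

HB.instance Definition _ :=
  Measure_isProbability.Build _ _ _ (average A0) average_setT.

End average.

Implicit Types (f : Om * borel X -> R) (mu : probability (Om * borel X)%type R).

(* Real functions on the bundle are represented by total functions on Om * X,
   only the values on the bundle being used; functions at distance 0 are not
   quotiented out. The measurability of the supremum contained in
   integrability is automatic when P is complete (measurable projection). *)
Definition L1_bundle f : Prop :=
  [/\ measurable_fun (bundle F) f,
      forall w, {within fibre w, continuous (fun x : X => f (w, x))} &
      P.-integrable [set: Om] (fun w =>
        ereal_sup [set (`|f (w, x)|)%:E | x in fibre w])].

Definition prob_bundle mu : Prop :=
  (forall A, measurable A -> pushforward mu fst A = P A) /\
  mu (bundle F) = 1%E.

Definition inv_prob_bundle mu : Prop :=
  prob_bundle mu /\
  forall g B, measurable B -> act_prob g mu B = mu B.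

Definition bundle_cvg (mu_ : nat -> probability (Om * borel X)%type R) mu :
    Prop :=
  forall f, L1_bundle f ->
    (fun n => \int[mu_ n]_(z in bundle F) (f z)%:E)%E @ \oo -->
    (\int[mu]_(z in bundle F) (f z)%:E)%E.

Section families.
Variable D : {fset G} -> Om * borel X -> R.

Definition subadditive_family : Prop :=
  {ae P, forall w, forall (A B : {fset G}) (g : G) (x : X),
    A != fset0 -> B != fset0 -> [disjoint A & rtranslate B g]%fset ->
    fibre w x ->
    D (A `|` rtranslate B g)%fset (w, x) <= D A (w, x) + D B (skew g (w, x))}.

Definition invariant_family : Prop :=
  {ae P, forall w, forall (A : {fset G}) (g : G) (x : X),
    A != fset0 -> fibre w x ->
    D (rtranslate A g) (w, x) = D A (skew g (w, x))}.

Definition family_average (A : {fset G}) mu : \bar R :=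
  ((#|` A|%:R^-1)%:E * \int[mu]_(z in bundle F) (D A z)%:E)%E.

(* Along a tiling Folner sequence and for invariant mu, this limit exists in
   [-oo, +oo[ and is the infimum of the sequence. *)
Definition family_mean (Fn : nat -> {fset G}) mu : \bar R :=
  limn (fun n => family_average (Fn n) mu).

End families.

End random_dynamics.

(* Main.v *)
(* The subsequence is found by coding X by the binary tree of cells cut out by a
   countable family of balls. A diagonal argument over this tree and over a
   countable family generating the measurable sets of Om modulo P makes
   mu_n (A x cell) converge for all A; the limits have densities with respect to
   P, and a random code on Om x [0, 1[ with these conditional probabilities
   defines a map Phi such that the image mu of P x Lebesgue under
   (w, u) |-> (w, Phi (w, u)) satisfies
   \int 1_A(w) h(x) dmu_n -> \int 1_A(w) h(x) dmu for continuous h. Since every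
   measure with marginal P is such an image, a measurable set S of Om x X lies,
   up to a null set, over a measurable subset of its projection, namely the w
   with |{u : (w, Phi (w, u)) in S}| > 0. This replaces the measurable projection
   theorem in showing that mu is carried by the bundle and that the convergence
   extends to all random continuous functions. The Folner property makes mu
   invariant.

   For the inequality, let A = F_m and let H = F_n. Averaging over h in A the
   sub-additive decompositions of H induced by the tilings {A c h}, and using
   commutativity, bounds |A| d_H by \sum_(c in H) d_A o c plus an error
   controlled by the boundary elements of H, whose proportion tends to 0.
   Integrating against nu_n, the limsup is at most |A|^-1 \int d_A dmu for every
   m. The same bound with nu_n = mu shows that the means along mu converge, and
   their limit is mu(D). *)

Require Import Defs.
From HB Require Import structures.
From mathcomp Require Import all_boot all_order all_algebra finmap.
From mathcomp Require Import all_classical all_reals all_analysis.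
From mathcomp Require Import measurable_realfun.
From mathcomp Require Import ring lra.

Set Implicit Arguments.
Unset Strict Implicit.
Unset Printing Implicit Defensive.
Import Order.TTheory GRing.Theory Num.Theory.
Import numFieldNormedType.Exports.

Local Open Scope classical_set_scope.
Local Open Scope ring_scope.

(** * Separability of Lebesgue spaces *)

(** Nothing makes the cells continuity sets: mass may drift to the boundary of a cell, so the limit
    of mu_n (A x cell) can differ from mu (A x cell). This is harmless because a code is decoded to
    a limit of points of its nested cells, possibly outside them, and mu is compared with mu_n on
    continuous functions only.

    The bundle has no topology in the direction of Om. Closedness of the fibres gives no closed
    subset of Om x X to which a portmanteau argument applies, and a random continuous function is
    not a priori approximated by combinations of products 1_A h. Both difficulties are met by
    cutting Om according to which basic open sets a fibre meets, or to which member of a countable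
    family approximates f on the fibre. These conditions on w are projections, whence the need for
    measurable sets lying under them. Such a set depends on the measure; it is chosen for each of
    the countably many measures involved, and the union over them is used. *)

Lemma lebesgue_space_induction (R : realType) d (T : measurableType d)
    (P : probability T R) : lebesgue_space P ->
  exists C : nat -> set T, (forall i, measurable (C i)) /\
  forall H : set (set T), (forall i, H (C i)) -> H setT ->
    (forall A B, measurable A -> measurable B -> B `<=` A ->
      H A -> H B -> H (A `\` B)) ->
    (forall F : (set T)^nat, (forall n, measurable (F n)) ->
      nondecreasing_seq F -> (forall n, H (F n)) -> H (\bigcup_n F n)) ->
    (forall A B, measurable A -> measurable B ->
      P (A `\` B) = 0%E -> P (B `\` A) = 0%E -> H A -> H B) ->
    forall A, measurable A -> H A.
Proof.
move=> [_ [_ [_ [m [_ _ _ [N [M [phi [[mN PN] [mM mM1] bphi Hmeas Hmu]]]]]]]]].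
have mpre B : measurable B -> measurable (~` N `&` phi @^-1` B).
  move=> mB; apply/Hmeas; first exact: subIsetl.
  have -> : phi @` (~` N `&` phi @^-1` B) = B `&` M.
    case: bphi => funphi _ surphi; apply/seteqP; split=> [_ [w [Nw Bw] <-]|y [By My]].
      by split=> //; exact: funphi.
    by have [w Nw wy] := surphi y My; exists w; rewrite //= wy; split.
  exists (B `&` M); first exact: measurableI.
  exists set0; first exact: negligible_set0.
  by rewrite setU0.
have [r rP] : exists r : nat -> R, forall x y, x < y -> exists i, x < r i < y.
  exists (fun i => ratr (odflt 0 (@choice.unpickle rat i))) => x y.
  move=> /rat_in_itvoo[q]; rewrite in_itv => xqy; exists (choice.pickle q).
  by rewrite choice.pickleK.
pose C i := ~` N `&` phi @^-1` `]-oo, r i[%classic.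
exists C; split=> [i|H HC HT HD HU HE A mA].
  by apply: mpre; exact: measurable_itv.
have mNC : measurable (~` N) by exact: measurableC.
have HN : H (~` N).
  apply: (HE setT) => //.
    by rewrite setTD setCK.
  by rewrite setDT measure0.
have H0 : H set0 by rewrite -(setDv setT); apply: HD.
(* Convergence on two sets says nothing about their intersection, so [H] is only a lambda-system;
   the rays, closed under intersection, supply the pi-system. *)
pose K (B : set (measurableTypeR R)) :=
  measurable B /\ H (~` N `&` phi @^-1` B).
have Kray x : K `]-oo, x[%classic.
  split; first exact: measurable_itv.
  (* A finite union of nested rays is one of them, so [H] holds for each [F n] although it is not
     assumed stable under finite unions. *)
  pose F n := \bigcup_(i in [set i | (i < n)%N /\ r i <= x]) `]-oo, r i[%classic.
  have FE n : F n = set0 \/ exists i, F n = `]-oo, r i[%classic.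
    elim: n => [|n ih].
      by left; apply/seteqP; split=> y // [i []].
    have [rx|rx] := boolP (r n <= x); last first.
      suff -> : F n.+1 = F n by [].
      apply/seteqP; split=> y [i [/= ilt rix] iy].
        exists i => //=; split=> //; move: ilt; rewrite ltnS leq_eqVlt.
        by case/orP=> // /eqP ein; rewrite ein (negbTE rx) in rix.
      by exists i => //=; split=> //; rewrite ltnW.
    have -> : F n.+1 = F n `|` `]-oo, r n[%classic.
      apply/seteqP; split=> y.
        move=> [i [/= ilt rix] iy]; move: ilt; rewrite ltnS leq_eqVlt.
        by case/orP=> [/eqP <-|ilt]; [right|left; exists i].
      move=> [[i [/= ilt rix] iy]|yn]; first by exists i => //=; rewrite ltnW.
      by exists n => //=; rewrite ltnSn.
    case: ih => [->|[i ->]]; first by rewrite set0U; right; exists n.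
    right; have [rin|rni] := leP (r i) (r n).
      exists n; apply/seteqP; split=> y /=; rewrite ?in_itv/=; last by right.
      by move=> [|//] /lt_le_trans; apply.
    exists i; apply/seteqP; split=> y /=; rewrite ?in_itv/=; last by left.
    by move=> [//|] /lt_trans; apply.
  have -> : `]-oo, x[%classic = \bigcup_n F n.
    apply/seteqP; split=> y /=.
      rewrite in_itv/= => /rP[i /andP[yi ix]].
      exists i.+1 => //; exists i; last by rewrite /= in_itv.
      by split=> //; exact: ltW.
    move=> [n _ [i [/= _ rix]]]; rewrite !in_itv/= => /lt_le_trans; exact.
  rewrite preimage_bigcup setI_bigcupr; apply: HU => n.
  - apply: mpre; case: (FE n) => [->|[i ->]]; [exact: measurable0|exact: measurable_itv].
  - move=> k nk; apply/subsetPset => w [Nw [i [/= ilt rx] iw]]; split=> //.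
    by exists i => //=; split=> //; exact: leq_trans nk.
  - case: (FE n) => [->|[i ->]]; last exact: HC.
    by rewrite preimage_set0 setI0.
have KB B : measurable B -> K B.
  have lK : lambda_system setT K.
    split=> [//||B1 B2|F ndF KF].
    - by split=> //; rewrite preimage_setT setIT.
    - move=> B21 [mB1 HB1] [mB2 HB2]; split; first exact: measurableD.
      have -> : ~` N `&` phi @^-1` (B1 `\` B2) =
          (~` N `&` phi @^-1` B1) `\` (~` N `&` phi @^-1` B2).
        apply/seteqP; split=> w /=; first by move=> [? []]; tauto.
        by move=> []; tauto.
      apply: HD => //; [exact: mpre|exact: mpre|].
      by move=> w [Nw Bw]; split=> //; exact: B21.
    - split; first by apply: bigcupT_measurable => n; case: (KF n).
      rewrite preimage_bigcup setI_bigcupr; apply: HU => n.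
      + by apply: mpre; case: (KF n).
      + move=> k nk; apply/subsetPset => w [Nw Fw]; split=> //.
        by have /subsetPset := ndF _ _ nk; apply.
      + by case: (KF n).
  move=> mB; have sB := mB.
  rewrite [_ B](congr1 (fun S => S B) (RGenInftyO.measurableE R)) in sB.
  apply: (lambda_system_subset _ lK _ _ sB) => //.
  - move=> _ _ [x ->] [y ->]; exists (Num.min x y).
    apply/seteqP; split=> z /=; rewrite !in_itv/= lt_min.
      by move=> [-> ->].
    by move=> /andP[].
  - by move=> _ [x ->]; exact: Kray.
(* The image of a measurable set is Borel only up to an [m]-null set: off [N], [A] is the preimage
   of a Borel set up to the preimage of a null Borel set [Z']. *)
have : completed_algebra_gen m (phi @` (A `\` N)).
  apply/Hmeas; first by move=> w [].
  exact: measurableD.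
move=> [B mB [Z [Z' [mZ' mZ0 ZZ']] BZ]].
have [_ HB] := KB B mB.
have PZ' : P (~` N `&` phi @^-1` Z') = 0%E by rewrite Hmu.
have mZN := mpre _ mZ'; have mBN := mpre _ mB.
have injphi : {in ~` N &, injective phi} by case: bphi.
have AE : A `\` N `<=` (~` N `&` phi @^-1` B) `|` (~` N `&` phi @^-1` Z').
  move=> w [Aw Nw]; have : (B `|` Z) (phi w) by rewrite BZ; exists w.
  by move=> [?|/ZZ' ?]; [left|right].
apply: (HE (~` N `&` phi @^-1` B)) => //.
  suff -> : (~` N `&` phi @^-1` B) `\` A = set0 by rewrite measure0.
  apply/seteqP; split=> // w [[Nw Bw] nAw].
  have : (B `|` Z) (phi w) by left.
  rewrite BZ => -[v [Av Nv] vw]; apply: nAw.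
  by rewrite -(injphi v w _ _ vw)//; rewrite inE.
apply/eqP; rewrite -measure_le0.
have -> : 0%E = (P N + P (~` N `&` phi @^-1` Z'))%E :> \bar R by rewrite PN PZ' adde0.
rewrite (le_trans _ (measureU2 _ _ _))//.
apply: le_measure; rewrite ?inE.
- exact: measurableD.
- exact: measurableU.
move=> w [Aw nBw]; have [Nw|Nw] := pselect (N w); first by left.
by right; case: (AE w (conj Aw Nw)).
Qed.

(** * Coding a compact metric space by nested cells *)

(** A cluster point [p] of the sequence in the cube, given by Tychonoff, replaces successive
    extractions: [s j] is taken beyond the previous index so that the first [j] coordinates of
    [u (s j)] are within [1 / (j + 1)] of [p]. *)
Lemma diagonal_subsequence (R : realType) (u : nat -> nat -> R) :
  (forall n i, 0 <= u n i <= 1) ->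
  exists s : nat -> nat, {homo s : i j / (i < j)%N} /\
    forall i, cvgn (fun j => u (s j) i).
Proof.
move=> u01.
have cK := @tychonoff nat (fun=> R : topologicalType) (fun=> `[0, 1]%classic)
  (fun=> @segment_compact R 0 1).
have [|p [_ pcl]] := cK (u @ \oo) _ _.
  by exists 0%N => // n _ i /=; rewrite in_itv/=.
pose T := prod_topology (fun _ : nat => (R : topologicalType)).
have near_k k e : 0 < e ->
    nbhs (p : T) [set f | forall i, (i < k)%N -> `|p i - f i| < e].
  move=> e0; elim: k => [|k ih].
    by apply: (@filterS _ _ (nbhs_filter (p : T)) setT) filterT.
  have pk : nbhs (p : T) [set f : T | `|p k - f k| < e].
    apply: (@proj_continuous nat (fun _ : nat => (R : topologicalType)) k p
      [set y | `|p k - y| < e]).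
    by apply/nbhs_ballP; exists e.
  apply: filterS2 pk ih => f /= fk ih i.
  by rewrite ltnS leq_eqVlt => /orP[/eqP ->|/ih].
have j0 j : 0 < j.+1%:R^-1 :> R by [].
have step N j : exists n, (N < n)%N /\
    forall i, (i < j)%N -> `|p i - u n i| < j.+1%:R^-1.
  have Nu : (u @ \oo) (u @` [set n | (N < n)%N]).
    by exists N.+1 => // n /= Nn; exists n.
  by have [_ [[n Nn <-] fn]] := pcl _ _ Nu (near_k j j.+1%:R^-1 (j0 j)); exists n.
pose g N j := projT1 (cid (step N j)).
have gP N j : (N < g N j)%N /\
    forall i, (i < j)%N -> `|p i - u (g N j) i| < j.+1%:R^-1.
  by rewrite /g; case: cid.
pose fix s j := if j is j'.+1 then g (s j') j else g 0%N 0%N.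
have sP j i : (i < j)%N -> `|p i - u (s j) i| < j.+1%:R^-1.
  by case: j => // j ij; case: (gP (s j) j.+1) => _; exact.
exists s; split.
  apply: homo_ltn; first exact: ltn_trans.
  by move=> i; case: (gP (s i) i.+1).
move=> i; apply/cvg_ex; exists (p i); apply/cvgrPdist_lt => e e0.
near=> j.
have ij : (i < j)%N by near: j; exact: nbhs_infty_gt.
apply: lt_trans (sP _ _ ij) _.
near: j; exact: near_infty_natSinv_lt (PosNum e0).
Unshelve. all: by end_near. Qed.

Section cells.
Context (R : realType) (X : pmetricType R).
Variable B : nat -> set X.

(* The bits of a code are read from the end of the list. *)
Fixpoint cell (b : seq bool) : set X :=
  if b is c :: b' then
    cell b' `&` (if c then B (size b') else ~` B (size b'))
  else setT.

(** An empty cell inherits the point of its parent. The points of the successive prefixes of an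
    arbitrary code then form a Cauchy sequence as soon as long cells are small, even if the cells
    end up empty. *)
Fixpoint cell_point (b : seq bool) : X :=
  if b is c :: b' then
    if pselect (exists x, cell b x) is left h then projT1 (cid h)
    else cell_point b'
  else point.

Lemma cell_cons b x : cell b x -> cell ((x \in B (size b)) :: b) x.
Proof.
by move=> bx; split=> //; case: ifPn => [/set_mem//|]; rewrite notin_setE.
Qed.

Lemma cell_inj b c x : size b = size c -> cell b x -> cell c x -> b = c.
Proof.
elim: b c => [|i b ih] [|j c]//= [bc] [bx ix] [cx jx].
have bcE := ih _ bc bx cx; rewrite bcE in ix *.
by case: i j ix jx => [] [].
Qed.

Lemma cell_code x k : exists2 b, size b = k & cell b x.
Proof.
elim: k => [|k [b bk bx]]; first by exists [::].
by exists ((x \in B (size b)) :: b); [rewrite /= bk|exact: cell_cons].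
Qed.

Lemma cell_pointP b x : cell b x -> cell b (cell_point b).
Proof.
case: b => [//|i b] bx /=; case: pselect => [h|[]]; last by exists x.
exact: (projT2 (cid h)).
Qed.

Lemma cell_cat b c : cell (c ++ b) `<=` cell b.
Proof. by elim: c => [//|i c ih] x [/ih]. Qed.

Lemma cell_point_cat b c :
  cell_point (c ++ b) = cell_point b \/ cell b (cell_point (c ++ b)).
Proof.
elim: c => [|i c ih]; first by left.
rewrite /=; case: pselect => [h|_] //; right.
have := projT2 (cid h); exact: (@cell_cat b (i :: c)).
Qed.

End cells.

Lemma measurable_cell (R : realType) (X : pmetricType R) (B : nat -> set X) b :
  (forall i, measurable (B i : set (borel X))) ->
  measurable (cell B b : set (borel X)).
Proof.
move=> mB; elim: b => [|[] b ih] /=; first exact: measurableT.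
  exact: measurableI.
by apply: measurableI => //; exact: measurableC.
Qed.

Lemma open_metric_ball (R : realType) (X : metricType R) (x : X) (e : R) :
  open (ball x e).
Proof.
rewrite openE => y; rewrite {1}ballEmdist/= => xy.
apply/nbhs_ballP; exists (e - mdist x y); first by rewrite /= subr_gt0.
move=> z; rewrite !ballEmdist /= ltrBrDl.
by apply: le_lt_trans; exact: metric_triangle.
Qed.

Lemma finite_net (R : realType) (X : pmetricType R) : compact [set: X] ->
  exists t : nat -> seq X,
    forall n x, exists2 y, y \in t n & mdist y x < n.+1%:R^-1.
Proof.
rewrite compact_cover => cov.
suff : forall n : nat, exists t : seq X,
    forall x, exists2 y, y \in t & mdist y x < n.+1%:R^-1.
  by move=> /choice[t tP]; exists t.
move=> n; have [|x _|t _ tcov] := cov X setT (fun y => ball y n.+1%:R^-1) _ _.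
- by move=> y _; exact: open_metric_ball.
- by exists x => //; apply: ballxx.
exists (enum_fset t) => x; have [y yt] := tcov x I.
by rewrite ballEmdist => yx; exists y.
Qed.

(* A sequence of balls containing, for each radius e, a finite cover by balls
   of radius e: points with the same first N bits are then 2 e-close. *)
Lemma small_cells (R : realType) (X : pmetricType R) : compact [set: X] ->
  exists B : nat -> set X, (forall i, open (B i)) /\
    forall e, 0 < e -> exists N, forall b x y, (N <= size b)%N ->
      cell B b x -> cell B b y -> mdist x y < e.
Proof.
move=> /finite_net[t tP].
pose B i := if (@choice.unpickle (nat * nat)%type i) is Some (n, k)
  then ball (nth point (t n) k) n.+1%:R^-1 else set0.
exists B; split=> [i|e e0].
  by rewrite /B; case: choice.unpickle => [[n k]|]; [exact: open_metric_ball|exact: open0].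
pose n := Num.truncn (2 / e).
have ne : n.+1%:R^-1 < e / 2.
  by rewrite -[ltRHS]invf_div ltf_pV2 ?posrE ?divr_gt0// truncnS_gt.
exists (\max_(k < size (t n)) (choice.pickle (n, nat_of_ord k)).+1)%N.
move=> b x y Nb bx by_.
have mem i z : (i < size b)%N -> cell B b z ->
    B i z <-> nth false (rev b) i.
  elim: b {Nb bx by_} => [//|c b ih] /=.
  rewrite ltnS leq_eqVlt rev_cons nth_rcons size_rev => /orP[/eqP ->|ib] [bz cz].
    by rewrite ltnn eqxx; case: c cz => cz; split.
  by rewrite ib; exact: ih.
have [z zt zx] := tP n x.
have kt : (index z (t n) < size (t n))%N by rewrite index_mem.
pose i := choice.pickle (n, index z (t n)).
have ib : (i < size b)%N.
  apply: leq_trans Nb; exact: (leq_bigmax_cond (Ordinal kt)).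
have Bi : B i = ball z n.+1%:R^-1 by rewrite /B choice.pickleK nth_index.
have : B i y.
  by apply/(mem _ _ ib by_)/(mem _ _ ib bx); rewrite Bi ballEmdist.
rewrite Bi ballEmdist /= => zy.
rewrite (le_lt_trans (metric_triangle _ z _))// metric_sym (splitr e) ltrD//.
  exact: lt_trans ne.
exact: lt_trans ne.
Qed.

(** * Densities of the limit measures on cells *)

(** Cauchy's criterion yields convergence without a candidate for the limit; this serves to pass to
    increasing unions of sets. *)
Lemma cvgn_uniform_approx (R : realType) (u : nat -> R) :
  (forall e, 0 < e -> exists2 v : nat -> R, cvgn v & forall n, `|u n - v n| <= e) ->
  cvgn u.
Proof.
move=> uv; apply/cauchy_cvgP/cauchy_ballP => e e0.
have e4 : 0 < e / 4 by rewrite divr_gt0.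
have [v /cvg_ex[l /cvgrPdist_lt vl] uvn] := uv _ e4.
exists (u @` [set n | `|l - v n| < e / 4], u @` [set n | `|l - v n| < e / 4]).
  by split; apply: filterS (vl _ e4) => n vn; exists n.
move=> [x y]/= [[n /= vn <-] [k /= vk <-]].
rewrite /ball/=.
have un := uvn n; have uk := uvn k.
rewrite (_ : u n - u k = (u n - v n) - (l - v n) + ((l - v k) - (u k - v k))); last by ring.
rewrite (le_lt_trans (ler_normD _ _))//.
rewrite (le_lt_trans (lerD (ler_normB _ _) (ler_normB _ _)))//.
lra.
Qed.

(** * Setwise limits of measures dominated by a probability *)

Section dominated_limit.
Local Open Scope ereal_scope.
Context (R : realType) d (T : measurableType d) (P : probability T R).
Variable m_ : nat -> {measure set T -> \bar R}.

(* The proofs m_le and m_cvg are arguments for the sake of the measure instance. *)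
Definition dominated_limit
    (m_le : forall n A, measurable A -> m_ n A <= P A)
    (m_cvg : forall A, measurable A -> cvgn (fun n => fine (m_ n A)))
    (A : set T) : \bar R := limn_esup (m_ ^~ A).

Hypothesis m_le : forall n A, measurable A -> m_ n A <= P A.
Hypothesis m_cvg : forall A, measurable A -> cvgn (fun n => fine (m_ n A)).
Local Notation limit_measure := (dominated_limit m_le m_cvg).

Let fin_m n A : measurable A -> m_ n A \is a fin_num.
Proof.
move=> mA; rewrite ge0_fin_numE// (le_lt_trans (m_le n mA))//.
by rewrite (le_lt_trans (probability_le1 _ _))// ltry.
Qed.

Lemma cvg_dominated_limit A : measurable A -> m_ ^~ A @ \oo --> limit_measure A.
Proof.
move=> mA; have /cvg_ex[l fl] := m_cvg mA.
have ml : m_ ^~ A @ \oo --> l%:E.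
  apply/fine_cvgP; split=> //; near=> n; exact: fin_m.
suff -> : limit_measure A = l%:E by [].
by rewrite /dominated_limit is_cvg_limn_esupE; [exact: cvg_lim|apply/cvg_ex; exists l%:E].
Unshelve. all: by end_near. Qed.

Let limit0 : limit_measure set0 = 0.
Proof.
have /cvg_lim <- // := cvg_dominated_limit measurable0.
rewrite (_ : m_ ^~ set0 = cst 0); first by rewrite lim_cst.
by apply/funext => n; rewrite measure0.
Qed.

Let limit_ge0 A : 0 <= limit_measure A.
Proof.
apply: limf_esup_ge0 => // -[n _ /(_ n)]; apply => /=; exact: leqnn.
Qed.

Lemma dominated_limit_le A : measurable A -> limit_measure A <= P A.
Proof.
move=> mA; have /cvg_lim <- // := cvg_dominated_limit mA.
apply: lime_le; last by apply: nearW => n; exact: m_le.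
by apply/cvg_ex; exists (limit_measure A); exact: cvg_dominated_limit.
Qed.

Let limit_fin A : measurable A -> limit_measure A \is a fin_num.
Proof.
move=> mA; rewrite ge0_fin_numE// (le_lt_trans (dominated_limit_le mA))//.
by rewrite (le_lt_trans (probability_le1 _ _))// ltry.
Qed.

Let limitU A B : measurable A -> measurable B -> A `&` B = set0 ->
  limit_measure (A `|` B) = limit_measure A + limit_measure B.
Proof.
move=> mA mB AB; have mAB := measurableU _ _ mA mB.
apply: (cvg_unique _ (cvg_dominated_limit mAB)) => //.
rewrite (_ : m_ ^~ (A `|` B) = (fun n => m_ n A + m_ n B)).
  by apply: cvgeD; [rewrite fin_num_adde_defr// limit_fin|exact: cvg_dominated_limit..].
by apply/funext => n; rewrite measureU.
Qed.

(** Domination makes this case of the Vitali-Hahn-Saks theorem elementary: the tails [V n] decrease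
    to the empty set, and their limit measure is at most [P (V n)]. *)
Let limit_sigma_additive : semi_sigma_additive limit_measure.
Proof.
move=> F mF tF mUF.
have mbig n : measurable (\big[setU/set0]_(i < n) F i).
  exact: bigsetU_measurable.
pose V n := \bigcup_k F k `\` \big[setU/set0]_(i < n) F i.
have mV n : measurable (V n) by exact: measurableD.
have subU n : \big[setU/set0]_(i < n) F i `<=` \bigcup_k F k.
  by rewrite -bigcup_mkord; apply: bigcup_sub => k _; exact: bigcup_sup.
have LE n : \sum_(0 <= i < n) limit_measure (F i) =
    limit_measure (\bigcup_k F k) - limit_measure (V n).
  have -> : \sum_(0 <= i < n) limit_measure (F i) =
      limit_measure (\big[setU/set0]_(i < n) F i).
    elim: n => [|n ih]; first by rewrite big_geq// big_ord0 limit0.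
    rewrite big_nat_recr//= big_ord_recr/= limitU//; first by rewrite ih.
      exact: mbig.
    apply/seteqP; split=> // x []; rewrite -bigcup_mkord => -[k /= kn Fk] Fn.
    by move: kn; rewrite (tF k n I I) ?ltnn//; exists x.
  have := limitU (mbig n) (mV n) (setDIK _ _).
  by rewrite setDUK// => ->; rewrite addeK// limit_fin.
rewrite (_ : (fun n => _) = (fun n => limit_measure (\bigcup_k F k) - limit_measure (V n)));
  last exact/funext.
rewrite -[X in _ --> X]sube0; apply: cvgeB.
- by rewrite fin_num_adde_defr// limit_fin.
- exact: cvg_cst.
have PV : P \o V @ \oo --> 0.
  rewrite -(@measure0 _ _ _ P).
  have -> : set0 = \bigcap_n V n.
    apply/seteqP; split=> // x VV; have [[k _ Fkx] _] := VV 0%N I.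
    have [_] := VV k.+1 I; rewrite -bigcup_mkord; apply.
    by exists k => //=.
  apply: nonincreasing_cvg_mu => //.
  - by rewrite (le_lt_trans (probability_le1 _ _))// ltry.
  - exact: bigcapT_measurable.
  - move=> n k nk; apply/subsetPset; apply: setDS.
    exact: subset_bigsetU.
apply: squeeze_cvge (cvg_cst 0) PV.
by apply: nearW => n; rewrite limit_ge0/= dominated_limit_le.
Qed.

HB.instance Definition _ := isMeasure.Build _ _ _ limit_measure
  limit0 limit_ge0 limit_sigma_additive.

HB.instance Definition _ := Measure_isFinite.Build _ _ _ limit_measure limit_fin.

End dominated_limit.

Lemma measurable_fst_preimage d1 d2 (T1 : measurableType d1)
    (T2 : measurableType d2) (A : set T1) :
  measurable A -> measurable (fst @^-1` A : set (T1 * T2)).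
Proof. by move=> mA; rewrite -[X in measurable X]setTI; exact: measurable_fst. Qed.

Lemma measurable_snd_preimage d1 d2 (T1 : measurableType d1)
    (T2 : measurableType d2) (B : set T2) :
  measurable B -> measurable (snd @^-1` B : set (T1 * T2)).
Proof. by move=> mB; rewrite -[X in measurable X]setTI; exact: measurable_snd. Qed.

Section cell_densities.
Local Open Scope ereal_scope.
Context (R : realType) d (Om : measurableType d) (P : probability Om R).
Context (X : pmetricType R).

Definition marginal (nu : probability (Om * borel X)%type R) : Prop :=
  forall A, measurable A -> nu (fst @^-1` A) = P A.

Section trace.
Context (nu : probability (Om * borel X)%type R).
Context (S : set (Om * borel X)) (mS : measurable S).

Definition fibre_trace : set Om -> \bar R :=
  pushforward (mrestr nu mS) (@fst Om (borel X)).

HB.instance Definition _ := Measure.copy fibre_trace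
  (measure_function_pushforward__canonical__measure_function_Measure
    (mrestr nu mS) (measurable_fst : measurable_fun setT (@fst Om (borel X)))).

End trace.

Lemma fibre_trace_le nu S (mS : measurable S) A : marginal nu -> measurable A ->
  fibre_trace nu mS A <= P A.
Proof.
move=> nuP mA; rewrite -nuP// /fibre_trace /pushforward /mrestr.
have mfA : measurable (@fst Om (borel X) @^-1` A).
  exact: measurable_fst_preimage.
exact: measureIl.
Qed.

Variables (B : nat -> set X) (mB : forall i, measurable (B i : set (borel X))).

Lemma measurable_snd_cell b :
  measurable ((@snd Om (borel X)) @^-1` (cell B b : set (borel X))).
Proof.
rewrite -[X in measurable X]setTI.
exact: (@measurable_snd _ _ Om (borel X) measurableT _ (measurable_cell b mB)).
Qed.

Local Notation mcell := measurable_snd_cell.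

Variable mu_ : nat -> probability (Om * borel X)%type R.
Hypothesis mu_P : forall n, marginal (mu_ n).
Hypothesis P_lebesgue : lebesgue_space P.

Lemma cell_densities : exists (s : nat -> nat) (rho : seq bool -> Om -> R),
  [/\ {homo s : i j / (i < j)%N},
      forall b, measurable_fun setT (rho b),
      forall b w, (0 <= rho b w)%R,
      forall A b, measurable A -> (fun j => mu_ (s j) (A `*` cell B b)) @ \oo -->
        \int[P]_(w in A) (rho b w)%:E &
      {ae P, forall w, rho [::] w = 1%R /\
        forall b, rho b w = (rho (false :: b) w + rho (true :: b) w)%R}].
Proof.
have [C [mC Cind]] := lebesgue_space_induction P_lebesgue.
(* Index 0 is reserved for the whole space, the other initial case of the induction principle. *)
pose C' k := if k is k'.+1 then C k' else setT.
pose m b n : {measure set Om -> \bar R} := fibre_trace (mu_ n) (mcell b).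
have m_le b n A : measurable A -> m b n A <= P A by exact: fibre_trace_le.
have P_fin A : measurable A -> P A \is a fin_num by exact: fin_num_measure.
have m_fin b n A : measurable A -> m b n A \is a fin_num.
  by move=> mA; rewrite ge0_fin_numE// (le_lt_trans (m_le b n A mA))// -ge0_fin_numE// P_fin.
have mD b n A A' : measurable A -> measurable A' -> A' `<=` A ->
    (fine (m b n (A `\` A')) = fine (m b n A) - fine (m b n A'))%R.
  move=> mA mA' A'A; rewrite measureD// ?setIidr//.
    by rewrite fineB// m_fin.
  by rewrite -ge0_fin_numE// m_fin.
pose u n i := if @choice.unpickle (nat * seq bool)%type i is Some (k, b)
  then fine (m b n (C' k)) else 0%R.
have mC' k : measurable (C' k) by case: k => [|k]; [exact: measurableT|exact: mC].
have [|s [s_homo u_cvg]] := @diagonal_subsequence R u.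
  move=> n i; rewrite /u; case: choice.unpickle => [[k b]|]; last by rewrite lexx ler01.
  rewrite fine_ge0//= -lee_fin fineK; last exact: m_fin.
  by rewrite (le_trans (m_le _ _ _ _))// probability_le1.
exists s.
have cC' k b : cvgn (fun j => fine (m b (s j) (C' k))).
  have := u_cvg (choice.pickle (k, b)).
  by rewrite /u choice.pickleK.
have m_cvg b A : measurable A -> cvgn (fun j => fine (m b (s j) A)).
  move: A; apply: Cind.
  - by move=> i; exact: (cC' i.+1).
  - exact: (cC' 0%N).
  - move=> A A' mA mA' A'A cA cA'.
    rewrite (_ : (fun j => _) = (fun j => fine (m b (s j) A) - fine (m b (s j) A'))%R).
      exact: is_cvgB.
    by apply/funext => j; rewrite mD.
  (* Replacing the union by [F N] costs at most the [P]-measure of their difference, uniformly in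
     [j]. *)
  - move=> F mF ndF cF; apply: cvgn_uniform_approx => e e0.
    have mU : measurable (\bigcup_n F n) by exact: bigcupT_measurable.
    have /fine_cvgP[_ /cvgrPdist_le /(_ _ e0)[N _ /(_ N (leqnn _))/= PN]] :
        P \o F @ \oo --> (fine (P (\bigcup_n F n)))%:E.
      by rewrite fineK ?P_fin//; exact: nondecreasing_cvg_mu.
    exists (fun j => fine (m b (s j) (F N))) => // j.
    have FU : F N `<=` \bigcup_n F n by exact: bigcup_sup.
    rewrite -mD// ger0_norm ?fine_ge0//.
    have PD : (fine (P (\bigcup_n F n `\` F N)) <= e)%R.
      rewrite measureD//; last by rewrite -ge0_fin_numE// P_fin.
      rewrite setIidr// fineB ?P_fin//.
      by rewrite (le_trans (ler_norm _)).
    apply: le_trans PD.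
    have mDF : measurable (\bigcup_n F n `\` F N) by exact: measurableD.
    by rewrite fine_le ?m_fin ?P_fin// m_le.
  - move=> A A' mA mA' PAA' PA'A cA.
    suff -> : (fun j => fine (m b (s j) A')) = (fun j => fine (m b (s j) A)) by [].
    apply/funext => j; congr fine.
    have m0 D : measurable D -> P D = 0 -> m b (s j) D = 0.
      by move=> mD' PD; apply/eqP; rewrite -measure_le0 -PD m_le.
    have DI D D' : measurable D -> measurable D' -> P (D `\` D') = 0 ->
        m b (s j) D = m b (s j) (D `&` D').
      move=> D1 D2 D0; have mDD := measurableD D1 D2.
      have := measureDI (m b (s j)) D1 D2.
      by rewrite (_ : _ (D `\` D') = 0) ?add0e//; exact: m0.
    by rewrite (DI A A')// (DI A' A)// setIC.
pose m_le' b j := m_le b (s j).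
pose L b : {finite_measure set Om -> \bar R} :=
  dominated_limit (m_le' b) (m_cvg b).
have LP b : L b `<< P.
  apply/null_content_dominatesP => A mA PA.
  apply/eqP; rewrite -measure_le0 -PA; exact: dominated_limit_le.
pose f b := Radon_Nikodym_SigmaFinite.f (L b) P.
have f0 b w : 0 <= f b w by exact: Radon_Nikodym_SigmaFinite.f_ge0.
have ffin b w : f b w \is a fin_num by exact: Radon_Nikodym_SigmaFinite.f_fin_num.
have fint b : P.-integrable setT (f b) by exact: Radon_Nikodym_SigmaFinite.f_integrable.
have Lf b A : measurable A -> L b A = \int[P]_(w in A) f b w.
  by move=> mA; exact: Radon_Nikodym_SigmaFinite.f_integral.
have L_cvg A b : measurable A -> (fun j => mu_ (s j) (A `*` cell B b)) @ \oo --> L b A.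
  move=> mA; exact: (@cvg_dominated_limit _ _ _ _ _ (m_le' b) (m_cvg b) A mA).
exists (fun b w => fine (f b w)); split=> //.
- move=> b; apply: measurableT_comp => //; exact: measurable_int (fint b).
- by move=> b w; apply: fine_ge0; exact: f0.
- move=> A b mA; under eq_integral do rewrite fineK//.
  by rewrite -Lf//; exact: L_cvg.
have ae1 : ae_eq P setT (f [::]) (cst 1).
  apply: integral_ae_eq => // A _ mA.
  rewrite -Lf// integral_cst// mul1e.
  apply: (cvg_unique _ (L_cvg A [::] mA)) => //.
  rewrite (_ : (fun j => _) = cst (P A)); first exact: cvg_cst.
  apply/funext => j; rewrite -(mu_P (s j) mA) /=; congr (mu_ _ _).
  by apply/seteqP; split=> z //= [].
have aeD b : ae_eq P setT (f b) (fun w => f (false :: b) w + f (true :: b) w).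
  apply: integral_ae_eq => //.
    by apply: emeasurable_funD; exact: measurable_int (fint _).
  move=> A _ mA; rewrite ge0_integralD//; last 2 first.
    by apply: measurable_funTS; exact: measurable_int (fint _).
    by apply: measurable_funTS; exact: measurable_int (fint _).
  rewrite -!Lf//; apply: (cvg_unique _ (L_cvg A b mA)) => //.
  rewrite (_ : (fun j => _) = (fun j => mu_ (s j) (A `*` cell B (false :: b)) +
      mu_ (s j) (A `*` cell B (true :: b)))).
    by apply: cvgeD; [rewrite fin_num_adde_defr// fin_num_measure|exact: L_cvg..].
  have mAc c : measurable (A `*` cell B c : set (Om * borel X)).
    by apply: measurableX => //; exact: measurable_cell.
  apply/funext => j; rewrite -measureU//.
    congr (mu_ _ _); apply/seteqP; split=> [z [Az bz]|z [] [Az [bz _]]//].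
    by have [Bz|Bz] := pselect (B (size b) z.2); [right|left].
  by apply/seteqP; split=> // z [] [_ [_ nBz]] [_ [_ Bz]].
(* Codes are countable, so one null set serves for all of them. *)
have aeD' : {ae P, forall w b, f b w = f (false :: b) w + f (true :: b) w}.
  pose Q (i : nat) w : Prop := if @choice.unpickle (seq bool) i is Some b then
    f b w = f (false :: b) w + f (true :: b) w else True.
  have : {ae P, forall w i, Q i w}.
    apply: (@ae_foralln _ _ _ P Q) => i; rewrite /Q.
    case: choice.unpickle => [b|]; last exact: aeW.
    by apply: filterS (aeD b) => w; apply.
  apply: filterS => w h b; have := h (choice.pickle b).
  by rewrite /Q choice.pickleK.
apply: filterS2 ae1 aeD' => w w1 wD; split.
  by rewrite w1.
by move=> b; rewrite wD fineD.
Qed.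
End cell_densities.

(** * Random measures as images of the uniform distribution *)

(** Heine's theorem, on a compact subset because random continuous functions are continuous on
    fibres only. *)
Lemma compact_uniform_continuity (R : realType) (X : pmetricType R)
    (K : set X) (h : X -> R) :
  compact K -> {within K, continuous h} -> forall e, 0 < e ->
  exists2 r, 0 < r & forall x y, K x -> K y -> mdist x y < r -> `|h x - h y| < e.
Proof.
move=> /compact_near_coveringP cK /subspace_continuousP ch e e0.
pose Q (r : R) x := forall y, K x -> K y -> mdist x y < r -> `|h x - h y| < e.
have [|r /= r0 rQ] := cK R (0^'+) Q _.
  move=> x Kx.
  have /cvgrPdist_lt/(_ (e / 2)) := ch x Kx.
  rewrite divr_gt0// => /(_ isT); rewrite near_withinE => /nbhs_ballP[r /= r0 xr].
  have r20 : 0 < r / 2 by rewrite divr_gt0.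
  exists (ball x (r / 2), [set s | s < r / 2]).
    by split=> /=; [exact: nbhsx_ballx|exact: nbhs_right_lt].
  move=> [x' s]/= [xx' sr] y Kx' Ky x'y.
  have xy : ball x r y.
    rewrite ballEmdist /= (le_lt_trans (metric_triangle _ x' _))//.
    rewrite ballEmdist /= in xx'.
    by rewrite (splitr r) ltrD// (lt_trans x'y).
  have xx'r : ball x r x'.
    by apply: le_ball xx'; rewrite ler_pdivrMr// ler_peMr ?ler1n// ltW.
  have := xr _ xy Ky; have := xr _ xx'r Kx' => /= h1 h2.
  rewrite (_ : h x' - h y = (h x - h y) - (h x - h x')); last by ring.
  by rewrite (le_lt_trans (ler_normB _ _))// (splitr e) ltrD.
exists (r / 2); first by rewrite divr_gt0.
move=> x y Kx Ky; apply: rQ => //=; last by rewrite divr_gt0.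
by rewrite sub0r normrN gtr0_norm ?divr_gt0// ltr_pdivrMr// ltr_pMr// ltr1n.
Qed.

Lemma continuous_borel_measurable (R : realType) (X : pmetricType R) (h : X -> R) :
  continuous h -> measurable_fun setT (h : borel X -> R).
Proof.
move=> /continuousP ch; apply: (measurability _ (RGenOInfty.measurableE R)).
move=> _ [_ [x ->] <-]; rewrite setTI; apply: sub_sigma_algebra.
by apply: ch; rewrite set_itvE; exact: open_gt.
Qed.

(** Used on both sides of a limit: the cells partition the space of [mu_ n], the level sets of the
    code that of P x Lebesgue. With the same constants [c], only the weights of the pieces remain to
    be compared. *)
Lemma Rintegral_finite_partition (R : realType) d (Z : measurableType d)
    (nu : probability Z R) (D : set Z) (f : Z -> R) (I : finType)
    (E : I -> set Z) (c : I -> R) (e : R) :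
  0 <= e -> measurable D -> measurable_fun D f -> (forall i, measurable (E i)) ->
  (forall z, D z -> exists i, E i z) ->
  (forall i j z, E i z -> E j z -> i = j) ->
  (forall i z, D z -> E i z -> `|f z - c i| <= e) ->
  `|\int[nu]_(z in D) f z - \sum_i c i * fine (nu (D `&` E i))| <= e.
Proof.
move=> e0 mD mf mE covE disjE fce.
have nu_fin A : measurable A -> nu A \is a fin_num by move=> ?; exact: fin_num_measure.
pose g z := \sum_i c i * \1_(E i) z.
have gE i z : E i z -> g z = c i.
  move=> Ez; rewrite /g (bigD1 i)//= indicE mem_set// mulr1 big1 ?addr0// => j ji.
  rewrite indicE memNset ?mulr0// => Ejz.
  by move/eqP: ji; apply; exact: disjE Ejz Ez.
have fge z : D z -> `|f z - g z| <= e.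
  by move=> Dz; have [i Ez] := covE z Dz; rewrite (gE _ _ Ez); exact: fce.
have mg : measurable_fun D g.
  apply: measurable_sum => i; apply: measurable_funM; first exact: measurable_cst.
  exact: measurable_indic.
have nuD : (nu D < +oo)%E by rewrite -ge0_fin_numE// nu_fin.
have ig : nu.-integrable D (EFin \o g).
  apply: measurable_bounded_integrable => //.
  exists (\sum_i `|c i|); split; first exact: num_real.
  move=> M /ltW cM z _ /=; apply: le_trans cM.
  rewrite /g (le_trans (ler_norm_sum _ _ _))// ler_sum// => i _.
  by rewrite normrM ler_piMr// indicE; case: (_ \in _); rewrite ?normr1 ?normr0.
have ifg : nu.-integrable D (EFin \o (fun z => f z - g z)).
  apply: measurable_bounded_integrable => //; first exact: measurable_funB.
  exists e; split; first exact: num_real.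
  by move=> M /ltW eM z Dz /=; apply: le_trans eM; exact: fge.
have -> : \int[nu]_(z in D) f z =
    \int[nu]_(z in D) (f z - g z) + \int[nu]_(z in D) g z.
  by rewrite -RintegralD//; apply: eq_Rintegral => z _; rewrite subrK.
have -> : \sum_i c i * fine (nu (D `&` E i)) = \int[nu]_(z in D) g z.
  rewrite /Rintegral /g.
  under eq_integral do rewrite -sumEFin.
  rewrite integral_sum//; last first.
    move=> i; under eq_fun do rewrite EFinM.
    apply: integrableZl => //.
    by apply: integrableS measurableT _ _ _ => //; exact: integrable_indic.
  rewrite -sum_fine.
    apply: eq_bigr => i _; under eq_integral do rewrite EFinM.
    rewrite integralZl//; last first.
      by apply: integrableS measurableT _ _ _ => //; exact: integrable_indic.
    by rewrite integral_indic// setIC fineM// nu_fin//; exact: measurableI.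
  move=> i _; under eq_integral do rewrite EFinM.
  rewrite integralZl//; last first.
    by apply: integrableS measurableT _ _ _ => //; exact: integrable_indic.
  by rewrite integral_indic// fin_numM// nu_fin//; exact: measurableI.
rewrite addrK (le_trans (le_normr_Rintegral mD ifg))//.
apply: (@le_trans _ _ (\int[nu]_(z in D) e)).
  apply: le_Rintegral => //.
  - by apply: (integrable_abse ifg).
  - exact: finite_measure_integrable_cst.
rewrite Rintegral_cst// ler_piMr// -lee_fin fineK ?nu_fin//.
exact: probability_le1.
Qed.

Definition unif01 (R : realType) : probability (measurableTypeR R) R :=
  uniform_prob (@ltr01 R).

Section uniform.
Context (R : realType).
Lemma uniform_prob_itvco (a r : R) : 0 <= a -> 0 <= r -> a + r <= 1 ->
  unif01 R `[a, (a + r)%R[%classic = r%:E.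
Proof.
move=> a0 r0 ar1; rewrite /unif01/= /uniform_prob.
rewrite (eq_integral (cst 1%E)); last first.
  move=> x; rewrite inE/= in_itv/= /uniform_pdf => /andP[ax xr].
  by rewrite (le_trans a0 ax) (ltW (lt_le_trans xr ar1)) subr0 invr1.
rewrite integral_cst//= mul1e lebesgue_measure_itv/= lte_fin.
case: ifPn => [_|]; first by rewrite -EFinB addrAC subrr add0r.
rewrite -leNgt -[X in _ <= X]addr0 lerD2l => r0'.
by congr EFin; apply/eqP; rewrite eq_le r0 r0'.
Qed.

(** Codes correspond to intervals only for [u] in [[0, 1[], which carries all the mass. *)
Lemma uniform_prob_trace (S S' : set R) : measurable S -> measurable S' ->
  (forall u, 0 <= u < 1 -> S u <-> S' u) -> unif01 R S = unif01 R S'.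
Proof.
move=> mS mS' SS'; pose D : set R := `[0%R, 1%R[%classic.
have mD : measurable D by exact: measurable_itv.
have UD : unif01 R D = 1%E.
  by have := @uniform_prob_itvco 0 1; rewrite add0r; apply.
have UDC V : measurable V -> unif01 R (V `\` D) = 0%E.
  move=> mV; apply/eqP; rewrite -measure_le0.
  have -> : 0%E = unif01 R (~` D) :> \bar R by rewrite probability_setC// [X in (1 - X)%E]UD subee.
  apply: le_measure; rewrite ?inE; [exact: measurableD|exact: measurableC|].
  by move=> u [].
have UI V : measurable V -> unif01 R V = unif01 R (V `&` D).
  move=> mV; transitivity (unif01 R (V `\` D) + unif01 R (V `&` D))%E.
    exact: measureDI.
  by rewrite UDC// add0e.
rewrite (UI S)// (UI S')//; congr (unif01 R _); apply/seteqP; split=> u [] + Du;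
  by have := Du; rewrite /D/= in_itv/= => /SS' SuS' Su; split=> //; apply/SuS'.
Qed.

End uniform.

Section code.
Context (R : realType) (T : Type) (rho : seq bool -> T -> R).

(** Left endpoint of the interval of length [rho b w] assigned to [b]; in the interval of the
    parent, the [false] child lies to the left of the [true] child. *)
Fixpoint lcum (b : seq bool) (w : T) : R :=
  if b is c :: b' then lcum b' w + (if c then rho (false :: b') w else 0) else 0.

(** A quantile transform: each new bit tells on which side of the cut between the two children the
    number [z.2] falls. *)
Fixpoint code (k : nat) (z : T * R) : seq bool :=
  if k is k'.+1 then
    let b := code k' z in (lcum b z.1 + rho (false :: b) z.1 <= z.2) :: b
  else [::].

Lemma size_code k z : size (code k z) = k.
Proof. by elim: k => //= k ->. Qed.

Lemma code_cat k l z : (k <= l)%N -> exists c, code l z = c ++ code k z.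
Proof.
move=> /subnK <-; elim: (l - k)%N => [|n [c cE]]; first by exists [::].
rewrite addSn /= cE; eexists (_ :: c); reflexivity.
Qed.

Section good.
Variable w : T.
Hypothesis rho_ge0 : forall b, 0 <= rho b w.
Hypothesis rho_nil : rho [::] w = 1.
Hypothesis rhoD : forall b, rho b w = rho (false :: b) w + rho (true :: b) w.

Lemma lcum_ge0 b : 0 <= lcum b w.
Proof. by elim: b => //= -[] b ih; rewrite addr_ge0. Qed.

Lemma lcum_le1 b : lcum b w + rho b w <= 1.
Proof.
elim: b => [|c b ih]; first by rewrite /= add0r rho_nil.
apply: le_trans ih; rewrite (rhoD b).
by case: c => /=; rewrite ?addr0 -?addrA lerD2l// lerDl.
Qed.

Lemma code_itv b u : 0 <= u < 1 ->
  code (size b) (w, u) = b <-> lcum b w <= u < lcum b w + rho b w.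
Proof.
move=> u01; elim: b => [|c b ih]; first by rewrite /= add0r rho_nil.
have rf := rho_ge0 (false :: b); have rt := rho_ge0 (true :: b).
rewrite [code _ _]/=; split=> [[] cE bE|].
  move: ih cE; rewrite bE => -[/(_ erefl)]; rewrite (rhoD b) => /= + _.
  by case: c => cE; lra.
have [bE|bE] := eqVneq (code (size b) (w, u)) b.
  rewrite bE => cu; congr (_ :: _); case: c cu => /= /andP[cu uc].
    exact: cu.
  by apply/negbTE; rewrite -ltNge; move: uc; rewrite addr0.
move=> cu; exfalso; move/eqP: bE; apply; apply/ih; rewrite (rhoD b).
by case: c cu => /=; lra.
Qed.

End good.
End code.

Section code_measure.
Local Open Scope ereal_scope.
Context (R : realType) d (T : measurableType d) (P : probability T R).
Variable rho : seq bool -> T -> R.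
Hypothesis mrho : forall b, measurable_fun setT (rho b).
Hypothesis rho_ge0 : forall b w, (0 <= rho b w)%R.
Hypothesis rho_ae : {ae P, forall w, rho [::] w = 1%R /\
  forall b, rho b w = (rho (false :: b) w + rho (true :: b) w)%R}.

Lemma measurable_lcum b : measurable_fun setT (lcum rho b).
Proof.
elim: b => [|c b ih] /=; first exact: measurable_cst.
by apply: measurable_funD => //; case: c => //; exact: measurable_cst.
Qed.

Lemma measurable_code k b :
  measurable [set z : T * measurableTypeR R | code rho k z = b].
Proof.
elim: k b => [|k ih] [|c b] /=.
- rewrite (_ : [set _ | _] = setT); first exact: measurableT.
  by apply/seteqP; split.
- rewrite (_ : [set _ | _] = set0); first exact: measurable0.
  by apply/seteqP; split.
- rewrite (_ : [set _ | _] = set0); first exact: measurable0.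
  by apply/seteqP; split.
pose f (z : T * measurableTypeR R) := (lcum rho b z.1 + rho (false :: b) z.1 <= z.2)%R.
have mf : measurable_fun setT f.
  apply: measurable_fun_ler; last exact: measurable_snd.
  apply: measurable_funD; apply: measurableT_comp (measurable_fst) => //.
  exact: measurable_lcum.
rewrite (_ : [set _ | _] = [set z | code rho k z = b] `&` (f @^-1` [set c])).
  apply: measurableI; first exact: ih.
  by rewrite -[X in measurable X]setTI; exact: mf.
apply/seteqP; split=> z /=.
  by move=> [cE bE]; split=> //; rewrite /f -bE.
by move=> [zb]; rewrite /f => <-; rewrite zb.
Qed.

Lemma code_prob A b : measurable A ->
  (P \x (unif01 R)) ((A `*` setT) `&` [set z | code rho (size b) z = b]) =
  \int[P]_(w in A) (rho b w)%:E.
Proof.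
move=> mA; rewrite [RHS]integral_mkcond/=.
set S := _ `&` _.
have mS : measurable S.
  by apply: measurableI; [exact: measurableX|exact: measurable_code].
apply: ae_eq_integral => //.
- exact: measurable_fun_xsection.
- by apply/(measurable_restrictT _ _).1 => //; apply: measurable_funTS; exact/measurable_EFinP.
apply: filterS rho_ae => w [w1 wD] _ /=.
rewrite patchE; case: ifPn => [/set_mem Aw|wA]; last first.
  rewrite (_ : xsection S w = set0) ?measure0//; apply/seteqP; split=> // u.
  by rewrite /xsection/= inE => -[[/= Aw _]]; rewrite (mem_set Aw) in wA.
rewrite -(@uniform_prob_itvco _ (lcum rho b w) (rho b w)); last 3 first.
- by apply: lcum_ge0 => b'; exact: rho_ge0.
- exact: rho_ge0.
- by apply: lcum_le1 => //.
apply: uniform_prob_trace.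
- exact: measurable_xsection.
- exact: measurable_itv.
move=> u u01; rewrite /xsection/= inE in_itv/= -code_itv//.
by split=> [[]|].
Qed.

End code_measure.

Section decoding.
Context (R : realType) d (T : measurableType d) (X : pmetricType R).
Variables (B : nat -> set X) (rho : seq bool -> T -> R).
Hypothesis X_compact : compact [set: X].

Definition small_at (N : nat) (e : R) := forall b x y, (N <= size b)%N ->
  cell B b x -> cell B b y -> mdist x y < e.

Lemma code_point_close N e k l z : 0 < e -> small_at N e ->
  (N <= k)%N -> (k <= l)%N ->
  mdist (cell_point B (code rho k z)) (cell_point B (code rho l z)) < e.
Proof.
move=> e0 Ne Nk kl; have [c ->] := code_cat rho z kl.
have [->|kc] := cell_point_cat B (code rho k z) c; first by rewrite mdistxx.
apply: (Ne (code rho k z) _ _ _ _ kc); first by rewrite size_code.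
exact: cell_pointP kc.
Qed.

(** A cluster point of the cell points of the prefixes exists by compactness, and it inherits the
    bounds of [code_point_close], which become weak inequalities. *)
Lemma decode_subproof : exists Phi : T * R -> X,
  forall N e k z, 0 < e -> small_at N e -> (N <= k)%N ->
    mdist (cell_point B (code rho k z)) (Phi z) <= e.
Proof.
suff : forall z, exists x, forall N e k, 0 < e -> small_at N e -> (N <= k)%N ->
    mdist (cell_point B (code rho k z)) x <= e.
  by move=> /choice[Phi PhiP]; exists Phi => N e k z; exact: PhiP.
move=> z.
have [|x [_ xcl]] := @X_compact ((fun k => cell_point B (code rho k z)) @ \oo) _ _.
  exact: filterT.
exists x => N e k e0 Ne Nk; apply/ler_addgt0Pl => r r0.
have [|y [[l /= kl <-]]] := xcl ((fun k => cell_point B (code rho k z)) @` [set l | (k <= l)%N]) (ball x r) _ (nbhsx_ballx _ _ r0).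
  by exists k => // l kl; exists l.
rewrite ballEmdist /= => xl.
rewrite (le_trans (metric_triangle _ (cell_point B (code rho l z)) _))//.
by rewrite addrC lerD// ?(ltW (code_point_close _ _ Ne _ _))// metric_sym ltW.
Qed.

Definition decode : T * R -> X := projT1 (cid decode_subproof).

Lemma decodeP N e k z : 0 < e -> small_at N e -> (N <= k)%N ->
  mdist (cell_point B (code rho k z)) (decode z) <= e.
Proof. by rewrite /decode; case: cid => /= Phi; exact. Qed.

Hypothesis mrho : forall b, measurable_fun setT (rho b).
Hypothesis B_small : forall e, 0 < e -> exists N, small_at N e.

Lemma measurable_decode : measurable_fun [set: T * measurableTypeR R]
  (decode : T * measurableTypeR R -> borel X).
Proof.
have /choice[N NP] : forall n, exists N, small_at N n.+1%:R^-1.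
  by move=> n; exact: B_small.
(* [decode] is a uniform limit of maps with countably many values: it lies in the closed set [C]
   exactly when, for every [n], the point of the code of length [N n] is within [1 / (n + 1)] of
   some point of [C]. *)
have mclosed (C : set X) : closed C -> measurable (decode @^-1` C : set (T * measurableTypeR R)).
  move=> cC.
  have -> : decode @^-1` C = \bigcap_n \bigcup_(b in [set b | exists2 y, C y &
      mdist (cell_point B b) y <= n.+1%:R^-1]) [set z | code rho (N n) z = b].
    apply/seteqP; split=> z.
      move=> Cz n _; exists (code rho (N n) z) => //=; exists (decode z) => //.
      exact: decodeP (NP n) _.
    move=> zC; apply: cC => V /nbhs_ballP[e /= e0 eV].
    pose n := Num.truncn (2 / e).
    have ne : n.+1%:R^-1 < e / 2.
      by rewrite -[ltRHS]invf_div ltf_pV2 ?posrE ?divr_gt0// truncnS_gt.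
    have [b [y Cy yb] /= zb] := zC n I; exists y; split=> //; apply: eV.
    rewrite ballEmdist/= (le_lt_trans (metric_triangle _ (cell_point B b) _))//.
    rewrite (splitr e) ltr_leD//; last exact: le_trans yb (ltW ne).
    rewrite metric_sym -zb; apply: le_lt_trans ne.
    exact: decodeP (NP n) _.
  apply: bigcapT_measurable => n.
  rewrite bigcup_mkcond; apply: countable_bigcupT_measurable => // b.
  by case: ifP => _; [exact: measurable_code|exact: measurable0].
apply: (@measurability _ _ _ (borel X) _ _ (@open X)) => //.
move=> _ [V oV <-]; rewrite setTI.
rewrite -[V]setCK preimage_setC; apply: measurableC;
exact: (mclosed (~` V) (open_closedC oV)).
Qed.

End decoding.

(** * Images of P x Lebesgue, and projections modulo null sets *)

Section fibred.
Context (R : realType) d (Om : measurableType d) (X : pmetricType R).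

(* A substitute for the measurable projection theorem: modulo nu, a measurable
   set lies over a measurable subset of its projection. *)
Definition fibred (nu : probability (Om * borel X)%type R) : Prop :=
  forall S, measurable S -> exists W : set Om,
    [/\ measurable W, forall w, W w -> exists x, S (w, x) &
        nu (S `\` (fst @^-1` W)) = 0%E].

End fibred.

Section graph.
Local Open Scope ereal_scope.
Context (R : realType) d (Om : measurableType d) (P : probability Om R).
Context (X : pmetricType R) (Phi : Om * measurableTypeR R -> borel X).

Definition graph_map (z : Om * measurableTypeR R) : Om * borel X := (z.1, Phi z).

Hypothesis mPhi : measurable_fun setT Phi.

Lemma measurable_graph_map : measurable_fun setT graph_map.
Proof. by apply/measurable_fun_pairP; split=> //; exact: measurable_fst. Qed.

(* The proof is an argument for the sake of the probability instance. *)
Definition graph_prob of measurable_fun setT Phi : set (Om * borel X) -> \bar R :=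
  pushforward (P \x unif01 R) graph_map.

HB.instance Definition _ := Measure.copy (graph_prob mPhi)
  (measure_function_pushforward__canonical__measure_function_Measure
    (P \x unif01 R) measurable_graph_map).

Let graph_prob_setT : graph_prob mPhi setT = 1.
Proof. by rewrite /graph_prob /pushforward preimage_setT probability_setT. Qed.

HB.instance Definition _ :=
  Measure_isProbability.Build _ _ _ (graph_prob mPhi) graph_prob_setT.

Lemma graph_prob_marginal : marginal P (graph_prob mPhi).
Proof.
move=> A mA; rewrite /= /graph_prob /pushforward.
rewrite (_ : graph_map @^-1` (fst @^-1` A) = A `*` setT).
  rewrite product_measure1E// [X in _ * X](_ : _ = 1) ?mule1//.
  exact: probability_setT.
by apply/seteqP; split=> z //= [].
Qed.

Lemma graph_prob_fibred : fibred (graph_prob mPhi).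
Proof.
move=> S mS; pose G := graph_map @^-1` S.
have mG : measurable G.
  by rewrite /G -[X in measurable X]setTI; exact: measurable_graph_map.
have mf := measurable_fun_xsection (unif01 R) mG.
exists [set w | 0 < unif01 R (xsection G w)]; split.
- have := mf measurableT `]0, +oo[%classic (emeasurable_itv _).
  by rewrite setTI; congr measurable; apply/seteqP; split=> w /=; rewrite in_itv/= andbT.
- move=> w /= Gw; apply: contrapT => /forallNP Sw.
  suff G0 : xsection G w = set0 by rewrite G0 measure0 ltxx in Gw.
  apply/seteqP; split=> // u; rewrite /xsection/= inE => Gwu.
  exact: (Sw _ Gwu).
rewrite /= /graph_prob /pushforward /product_measure1 integral0_eq// => w _ /=.
have [Gw|Gw] := ltP 0 (unif01 R (xsection G w)).
  rewrite (_ : xsection _ w = set0) ?measure0//.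
  by apply/seteqP; split=> // u; rewrite /xsection/= inE => -[_] [].
apply/eqP; rewrite -measure_le0; apply: le_trans Gw.
apply: le_measure; rewrite ?inE; try exact: measurable_xsection.
  apply: measurable_xsection; rewrite -[X in measurable X]setTI.
  apply: measurable_graph_map => //; apply: measurableD => //.
  apply: measurable_fst_preimage.
  have := mf measurableT `]0, +oo[%classic (emeasurable_itv _).
  by rewrite setTI; congr measurable; apply/seteqP; split=> v /=; rewrite in_itv/= andbT.
by move=> u; rewrite /xsection/= !inE => -[].
Qed.

Lemma Rintegral_graph_prob A (h : X -> R) : measurable A ->
  measurable_fun setT (h : borel X -> R) -> (exists M, forall x, (`|h x| <= M)%R) ->
  (\int[graph_prob mPhi]_(z in fst @^-1` A) h z.2 =
   \int[P \x unif01 R]_(z in A `*` setT) h (Phi z))%R.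
Proof.
move=> mA mh [M hM]; congr fine.
have mhs : measurable_fun setT (fun z : Om * borel X => (h z.2)%:E).
  by apply/measurable_EFinP; exact: measurableT_comp mh measurable_snd.
have AE : A `*` setT = graph_map @^-1` (fst @^-1` A).
  by apply/seteqP; split=> z //= [].
have mAT : measurable (A `*` setT : set (Om * measurableTypeR R)).
  exact: measurableX.
rewrite AE; apply: (integral_pushforward measurable_graph_map mhs).
  rewrite -AE; apply: measurable_bounded_integrable => //.
  - exact: le_lt_trans (probability_le1 (P \x unif01 R) mAT) (ltry _).
  - by apply: measurable_funTS; exact: measurableT_comp mh mPhi.
  exists M; split; first exact: num_real.
  by move=> N /ltW MN z _ /=; apply: le_trans MN; exact: hM.
exact: measurable_fst_preimage.
Qed.

End graph.

Lemma cvgn_approx (R : realType) (u : nat -> R) (l : R) :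
  (forall e, 0 < e -> exists (v : nat -> R) (m : R),
    [/\ v @ \oo --> m, forall n, `|u n - v n| <= e & `|l - m| <= e]) ->
  u @ \oo --> l.
Proof.
move=> uv; apply/cvgrPdist_le => e e0.
have e3 : 0 < e / 3 by rewrite divr_gt0.
have [v [m [/cvgrPdist_le/(_ _ e3) vm unv lm]]] := uv _ e3.
apply: filterS vm => n vmn; have := unv n => uvn.
rewrite (_ : l - u n = (l - m) + (m - v n) - (u n - v n)); last by ring.
rewrite (le_trans (ler_normB _ _))//.
have := ler_normD (l - m) (m - v n); lra.
Qed.

(** * Compactness of the space of random measures *)

Section compactness.
Context (R : realType) d (Om : measurableType d) (P : probability Om R).
Context (X : pmetricType R).
Hypothesis P_lebesgue : lebesgue_space P.
Hypothesis X_compact : compact [set: X].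

Lemma continuous_bounded (h : X -> R) : continuous h ->
  exists M, forall x, `|h x| <= M.
Proof.
move=> ch; have : compact (h @` setT).
  by apply: continuous_compact => //; exact: continuous_subspaceT.
move=> /compact_bounded[M [_ hM]]; exists (M + 1) => x.
by apply: hM; [rewrite ltrDl|exists x].
Qed.

(** For [N] large, [h] varies by at most [e] on each cell of length [N], and also between [decode z]
    and the point of its prefix of length [N]. Both integrals are then within [e] of finite sums
    with coefficients [c b], and the weights in the first sum converge to those in the second by
    [cell_densities] and [code_prob]. *)
Lemma random_measure_compactness
    (mu_ : nat -> probability (Om * borel X)%type R) :
  (forall n, marginal P (mu_ n)) ->
  exists (s : nat -> nat) (mu : probability (Om * borel X)%type R),
  [/\ {homo s : i j / (i < j)%N}, marginal P mu, fibred mu &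
    forall A h, measurable A -> continuous h ->
    (fun j => \int[mu_ (s j)]_(z in fst @^-1` A) h z.2) @ \oo -->
    \int[mu]_(z in fst @^-1` A) h z.2].
Proof.
move=> mu_P.
have [B [oB Bsmall]] := small_cells X_compact.
have mB i : measurable (B i : set (borel X)) by apply: sub_sigma_algebra; exact: oB.
have [s [rho [s_homo mrho rho0 mu_cvg rho_ae]]] := cell_densities mB mu_P P_lebesgue.
have mPhi := measurable_decode X_compact mrho Bsmall.
exists s, (graph_prob P mPhi); split => //.
- exact: graph_prob_marginal.
- exact: graph_prob_fibred.
move=> A h mA ch.
have mh := continuous_borel_measurable ch.
rewrite Rintegral_graph_prob//; last exact: continuous_bounded.
apply: cvgn_approx => e e0.
have [r r0 hr'] := compact_uniform_continuity X_compact (continuous_subspaceT ch) e0.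
have hr x y : mdist x y < r -> `|h x - h y| < e by exact: hr'.
(* Half of [r], because [decodeP] gives a weak inequality and [hr] asks for a strict one. *)
have [N Nr] := Bsmall _ (divr_gt0 r0 (@ltr0Sn R 1)).
have rr : r / 2 < r by rewrite ltr_pdivrMr// ltr_pMr// ltr1n.
pose c (b : N.-tuple bool) := h (cell_point B b).
have mfA : measurable (fst @^-1` A : set (Om * borel X)).
  exact: measurable_fst_preimage.
exists (fun j => \sum_b c b * fine (mu_ (s j) (fst @^-1` A `&` snd @^-1` (cell B b)))).
exists (\sum_b c b *
  fine ((P \x unif01 R)%E ((A `*` setT) `&` [set z | code rho N z = b]))).
split.
- apply: cvg_big => [|b _]; first exact: add_continuous.
  apply: cvgMr; apply: fine_cvg.
  have -> : [set z | code rho N z = b] = [set z | code rho (size b) z = b].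
    by rewrite size_tuple.
  have bfin : (P \x unif01 R)%E (A `*` setT `&` [set z | code rho (size b) z = b]) \is a fin_num.
    have mS : measurable (A `*` setT `&` [set z : Om * measurableTypeR R | code rho (size b) z = b]).
      by apply: measurableI; [exact: measurableX|exact: measurable_code].
    rewrite ge0_fin_numE//.
    exact: le_lt_trans (probability_le1 (P \x unif01 R)%E mS) (ltry _).
  rewrite fineK//; rewrite (code_prob mrho rho0 rho_ae)//; exact: mu_cvg.
- move=> j; apply: Rintegral_finite_partition => //; first exact: ltW.
  + by apply: measurable_funTS; exact: measurableT_comp mh measurable_snd.
  + by move=> b; exact: measurable_snd_cell.
  + move=> z _; have [b bN bz] := cell_code B z.2 N.
    by exists (tcast bN (in_tuple b)); rewrite /= val_tcast.
  + move=> b b' z bz b'z; apply/val_inj; apply: cell_inj bz b'z.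
    by rewrite !size_tuple.
  + move=> b z _ bz; apply/ltW/hr; apply: lt_trans rr.
    by apply: (Nr b) => //; [rewrite size_tuple|exact: cell_pointP bz].
- apply: Rintegral_finite_partition => //; first exact: ltW.
  + exact: measurableX.
  + by apply: measurable_funTS; exact: measurableT_comp mh mPhi.
  + by move=> b; exact: measurable_code.
  + move=> z _; have cN := size_code rho N z.
    by exists (tcast cN (in_tuple (code rho N z))); rewrite /= val_tcast.
  + by move=> b b' z /= -> /val_inj.
  + move=> b z _ /= bz; apply/ltW/hr; rewrite metric_sym; apply: le_lt_trans rr.
    by rewrite -bz; apply: decodeP Nr _ => //; rewrite divr_gt0.
Qed.

(** The distance to [C] truncated at 1; the element 1 of [S x] also keeps the infimum meaningful
    when [C] is empty. *)
Lemma closed_zero_set (C : set X) : closed C -> exists g : X -> R,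
  [/\ continuous g, forall x, 0 <= g x <= 1 & forall x, g x = 0 <-> C x].
Proof.
move=> cC; pose S x : set R := 1 |` (mdist x @` C).
pose g x := inf (S x).
have S1 x : S x 1 by left.
have S0 x : lbound (S x) 0 by move=> _ [->|[y _ <-]] //; exact: mdist_ge0.
have gle x t : S x t -> g x <= t by move=> St; apply: ge_inf => //; exists 0.
have g0 x : 0 <= g x by apply: lb_le_inf => //; exists 1.
have glip x y : g x <= mdist x y + g y.
  rewrite -lerBlDl; apply: lb_le_inf; first by exists 1.
  move=> _ [->|[c Cc <-]]; rewrite lerBlDl.
    by rewrite (le_trans (gle _ _ (S1 x)))// lerDr mdist_ge0.
  apply: le_trans (metric_triangle _ y _); apply: gle; right; by exists c.
exists g; split.
- move=> x; apply/cvgrPdist_lt => e e0; apply/nbhs_ballP; exists e => // y.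
  rewrite ballEmdist /= => xy; apply: le_lt_trans xy.
  by rewrite ler_norml; have := glip x y; have := glip y x; rewrite (metric_sym y x); lra.
- by move=> x; rewrite g0 gle.
move=> x; split=> [gx|Cx]; last first.
  apply/eqP; rewrite eq_le g0 andbT; apply: gle; right.
  by exists x => //; rewrite mdistxx.
apply: cC => V /nbhs_ballP[e /= e0 eV].
have e1 : g x < Num.min e 1 by rewrite gx lt_min e0 ltr01.
have [|_ [->|[c Cc <-]]] := inf_lt _ e1; first by exists 1.
  by rewrite lt_min ltxx andbF.
by rewrite lt_min => /andP[xc _]; exists c; split=> //; apply: eV; rewrite ballEmdist.
Qed.

(** Closed sets [C] are reached by dominated convergence, the continuous functions [h k] decreasing
    to the indicator of [C]. Open sets follow by complement and generate [borel X]; two uniqueness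
    arguments then give rectangles and all measurable sets. *)
Lemma random_measure_unique (nu nu' : probability (Om * borel X)%type R) :
  (forall A h, measurable A -> continuous h ->
    \int[nu]_(z in fst @^-1` A) h z.2 = \int[nu']_(z in fst @^-1` A) h z.2) ->
  forall S, measurable S -> nu S = nu' S.
Proof.
move=> nuE.
have mfA A : measurable A -> measurable (fst @^-1` A : set (Om * borel X)).
  exact: measurable_fst_preimage.
have msB (B : set (borel X)) : measurable B -> measurable (snd @^-1` B : set (Om * borel X)).
  exact: measurable_snd_preimage.
have mclosed (C : set X) : closed C -> measurable (C : set (borel X)).
  move=> cC; rewrite -[C]setCK; apply: measurableC; apply: sub_sigma_algebra.
  exact: closed_openC.
have nu1 (m : probability (Om * borel X)%type R) S : measurable S -> (m S < +oo)%E.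
  by move=> mS; exact: le_lt_trans (probability_le1 m mS) (ltry _).
have closedE A (C : set X) : measurable A -> closed C ->
    nu (fst @^-1` A `&` snd @^-1` C) = nu' (fst @^-1` A `&` snd @^-1` C).
  move=> mA cC; have [g [cg g01 gC]] := closed_zero_set cC.
  pose h k x := Num.max 0 (1 - k%:R * g x).
  have ch k : continuous (h k).
    move=> x; apply: (@continuous_max _ _ (cst 0) (fun x => 1 - k%:R * g x));
      first exact: cst_continuous.
    by apply: cvgB; [exact: cvg_cst|apply: cvgMr; exact: cg].
  have h01 k x : 0 <= h k x <= 1.
    rewrite /h le_max lexx/= ge_max ler01/= gerBl mulr_ge0//.
    by case/andP: (g01 x).
  have key (m : probability (Om * borel X)%type R) :
      (fun k => \int[m]_(z in fst @^-1` A) (h k z.2)%:E)%E @ \oo -->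
      m (fst @^-1` A `&` snd @^-1` C).
    rewrite setIC -(integral_indic m (mfA _ mA) (msB _ (mclosed _ cC))).
    apply: (@dominated_cvg _ _ _ _ _ _ _ _ (cst 1%E)) => //.
    - exact: mfA.
    - move=> k; apply: measurable_funTS; apply/measurable_EFinP.
      by apply: measurableT_comp measurable_snd; exact: continuous_borel_measurable.
    - move=> z _; apply: cvg_EFin; first exact: nearW.
      rewrite /comp/=; have [Cz|nCz] := pselect (C z.2).
        rewrite indicE mem_set//; apply: cvg_near_cst; apply: nearW => k.
        by rewrite /h (gC z.2).2// mulr0 subr0 max_r.
      rewrite indicE memNset//; apply: cvg_near_cst.
      have gz : 0 < g z.2.
        rewrite lt_neqAle; case/andP: (g01 z.2) => -> _; rewrite andbT.
        by apply/negP => /eqP/esym/gC.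
      near=> k; rewrite /h max_l// subr_le0.
      rewrite -ler_pdivrMr// div1r; near: k; exact: nbhs_infty_ger.
    - exact: finite_measure_integrable_cst (mfA _ mA).
    - move=> k z _ /=; rewrite lee_fin; case/andP: (h01 k z.2) => h0 h1.
      by rewrite ger0_norm.
  have intE k : (\int[nu]_(z in fst @^-1` A) (h k z.2)%:E =
      \int[nu']_(z in fst @^-1` A) (h k z.2)%:E)%E.
    have hint (m : probability (Om * borel X)%type R) :
        m.-integrable (fst @^-1` A) (fun z => (h k z.2)%:E).
      apply: measurable_bounded_integrable; [exact: mfA|exact: nu1 (mfA _ mA)|..].
        apply: measurable_funTS.
        by apply: measurableT_comp measurable_snd; exact: continuous_borel_measurable.
      exists 1; split => // M /ltW M1 z _ /=; apply: le_trans M1.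
      by rewrite ger0_norm; case/andP: (h01 k z.2).
    have /(congr1 (@EFin R)) := nuE _ _ mA (ch k).
    rewrite /Rintegral !fineK//; apply: integrable_fin_num (hint _); exact: mfA.
  apply: (cvg_unique _ (key nu)) => //.
  by rewrite (funext intE); exact: key.
have rectE A (B : set (borel X)) : measurable A -> measurable B ->
    nu (A `*` B) = nu' (A `*` B).
  move=> mA mB.
  have openE (U : set X) : open U ->
      nu (fst @^-1` A `&` snd @^-1` U) = nu' (fst @^-1` A `&` snd @^-1` U).
    move=> oU; have cU := open_closedC oU.
    have split_m (m : probability (Om * borel X)%type R) :
        m (fst @^-1` A `&` snd @^-1` U) =
        (m (fst @^-1` A `&` snd @^-1` setT) -
         m (fst @^-1` A `&` snd @^-1` (~` U)))%E.
      have mC : measurable (fst @^-1` A `&` snd @^-1` (~` U) : set (Om * borel X)).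
        by apply: measurableI; [exact: mfA|apply: msB; exact: mclosed].
      rewrite preimage_setT setIT.
      have <- : fst @^-1` A `\` (fst @^-1` A `&` snd @^-1` (~` U)) =
          fst @^-1` A `&` snd @^-1` U :> set (Om * borel X).
        apply/seteqP; split=> z [Az].
          by move=> h; split=> //; apply: contrapT => nU; exact: h.
        by move=> Uz; split=> // -[_]; exact.
      rewrite measureD//; [|exact: mfA|exact: nu1 (mfA _ mA)].
      by rewrite setIA setIid.
    by rewrite !split_m !closedE//; exact: closedT.
  pose m1 (m : probability (Om * borel X)%type R) : {measure set borel X -> \bar R} :=
    measure_function_pushforward__canonical__measure_function_Measure
      (mrestr m (mfA _ mA)) (measurable_snd : measurable_fun setT (@snd Om (borel X))).
  have m1lt (m : probability (Om * borel X)%type R) : (m1 m setT < +oo)%E.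
    exact: nu1 (measurableI _ _ (msB _ measurableT) (mfA _ mA)).
  have rectE' : m1 nu B = m1 nu' B.
    apply: (@measure_unique _ _ (borel X) (@open X) (fun=> setT)) => //.
    - by move=> ? ?; exact: openI.
    - by move=> _; exact: openT.
    - by rewrite bigcup_const.
    - move=> U /openE UE; rewrite [LHS](_ : _ = nu (snd @^-1` U `&` fst @^-1` A))//.
      by rewrite setIC UE setIC.
  rewrite (_ : A `*` B = snd @^-1` B `&` fst @^-1` A); first exact: rectE'.
  by rewrite setIC.
apply: (@measure_unique _ _ _ [set A `*` B | A in measurable & B in measurable] (fun=> setT)).
- exact: measurable_prod_measurableType.
- move=> _ _ [A mA [B mB <-]] [A' mA' [B' mB' <-]].
  exists (A `&` A'); first exact: measurableI.
  by exists (B `&` B'); [exact: measurableI|rewrite setXI].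
- by move=> _; exists setT => //; exists setT => //; rewrite setXTT.
- by rewrite bigcup_const.
- by move=> _ [A mA [B mB <-]]; exact: rectE.
- by move=> _; exact: nu1.
Unshelve. all: by end_near. Qed.

(** Compactness is applied to the constant sequence [nu]: the limit it produces is an image of P x
    Lebesgue, and it coincides with [nu] because both have the same integrals of test functions. *)
Lemma marginal_fibred (nu : probability (Om * borel X)%type R) :
  marginal P nu -> fibred nu.
Proof.
move=> nuP; have [s [mu [_ _ mu_fib nu_mu]]] := random_measure_compactness (fun _ : nat => nuP).
have nuE : forall S, measurable S -> nu S = mu S.
  apply: random_measure_unique => A h mA ch.
  apply: (cvg_unique _ _ (nu_mu A h mA ch)) => //.
  exact: cvg_cst.
move=> S mS; have [W [mW WS muW]] := mu_fib S mS; exists W; split=> //.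
rewrite nuE//; apply: measurableD => //.
exact: measurable_fst_preimage.
Qed.

End compactness.

(** * Convergence against random continuous functions *)

Lemma compact_open_sequence (R : realType) (X : pmetricType R) :
  compact [set: X] -> exists U : nat -> set X, (forall i, open (U i)) /\
    forall x V, nbhs x V -> exists i, U i x /\ U i `<=` V.
Proof.
move=> /compact_second_countable[B /pfcard_geP[->|/unsquash f] [Bo Bx]].
  by have [U []] := Bx point setT filterT.
exists f; split=> [i|x V xV]; first by apply: Bo; exact: funS.
have [U [BU Ux] UV] := Bx x V xV.
by have [i _ fi] := 'surj_f BU; exists i; rewrite fi; split.
Qed.

(** * Integrals against a measure with marginal [P] *)

Section marginal_integral.
Local Open Scope ereal_scope.
Context (R : realType) d (Om : measurableType d) (P : probability Om R).
Context (X : pmetricType R) (m : probability (Om * borel X)%type R).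
Hypothesis mP : marginal P m.

Lemma marginal_integral (k : Om -> \bar R) : measurable_fun setT k ->
  (forall w, 0 <= k w) -> \int[m]_z k z.1 = \int[P]_w k w.
Proof.
move=> mk k0.
have := @ge0_integral_pushforward _ _ _ _ R (@fst Om (borel X))
  measurable_fst m setT k measurableT mk (fun w _ => k0 w).
rewrite preimage_setT => <-; apply: eq_measure_integral => A mA _.
exact: mP.
Qed.

Lemma marginal_setC_eq0 A : measurable A -> P A = 0 -> m (fst @^-1` A) = 0.
Proof. by move=> mA; rewrite mP. Qed.

Lemma marginal_integrable (D : set (Om * borel X)) (f : Om * borel X -> R)
    (k : Om -> R) : measurable D -> measurable_fun D f ->
  P.-integrable setT (EFin \o k) -> (forall z, D z -> (`|f z| <= k z.1)%R) ->
  m.-integrable D (EFin \o f).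
Proof.
move=> mD mf ik fk.
have mk : measurable_fun setT (abse \o (EFin \o k)).
  by apply: measurableT_comp => //; exact: measurable_int ik.
apply/integrableP; split; first exact/measurable_EFinP.
have kfin : \int[P]_w `|(k w)%:E| < +oo by case/integrableP : ik.
apply: le_lt_trans kfin; rewrite -(marginal_integral mk (fun w => abse_ge0 _)).
apply: (@le_trans _ _ (\int[m]_(z in D) `|(k z.1)%:E|)).
  apply: ge0_le_integral => //.
  - by apply: measurableT_comp => //; exact/measurable_EFinP.
  - by apply: measurable_funTS; exact: measurableT_comp mk measurable_fst.
  - by move=> z Dz; rewrite lee_fin (le_trans (fk z Dz))// ler_norm.
apply: ge0_subset_integral => //.
exact: measurableT_comp mk measurable_fst.
Qed.

Lemma Rintegral_dist_le (D : set (Om * borel X)) (f g : Om * borel X -> R)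
    (k : Om -> \bar R) : measurable D ->
  m.-integrable D (EFin \o f) -> m.-integrable D (EFin \o g) ->
  measurable_fun setT k -> (forall w, 0 <= k w) ->
  (forall z, D z -> (`|f z - g z|)%:E <= k z.1) ->
  (`|(\int[m]_(z in D) f z)%R - (\int[m]_(z in D) g z)%R|)%:E <= \int[P]_w k w.
Proof.
move=> mD intf intg mk k0 fgk.
have ifg : m.-integrable D (EFin \o (fun z => f z - g z)%R).
  by have := integrableB mD intf intg.
rewrite -RintegralB// -(marginal_integral mk k0).
rewrite (@le_trans _ _ (\int[m]_(z in D) (`|f z - g z|)%:E))//.
  rewrite /Rintegral -fine_abse; last exact: integrable_fin_num.
  rewrite fineK; last by rewrite abse_fin_num integrable_fin_num.
  apply: le_abse_integral => //.
  exact: measurable_int ifg.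
apply: (@le_trans _ _ (\int[m]_(z in D) k z.1)).
  apply: ge0_le_integral => //.
  - apply/measurable_EFinP; apply: measurableT_comp => //.
    by apply/measurable_EFinP; exact: measurable_int ifg.
  - by apply: measurable_funTS; exact: measurableT_comp mk measurable_fst.
apply: ge0_subset_integral => //.
exact: measurableT_comp mk measurable_fst.
Qed.

End marginal_integral.

Section support.
Local Open Scope ereal_scope.
Context (R : realType) d (Om : measurableType d) (P : probability Om R).
Context (X : pmetricType R).
Hypothesis P_lebesgue : lebesgue_space P.
Hypothesis X_compact : compact [set: X].
Variables (nu_ : nat -> probability (Om * borel X)%type R)
  (mu : probability (Om * borel X)%type R).
Hypothesis nu_P : forall n, marginal P (nu_ n).
Hypothesis mu_P : marginal P mu.
Hypothesis nu_mu : forall A h, measurable A -> continuous h ->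
  ((fun j => \int[nu_ j]_(z in fst @^-1` A) h z.2) @ \oo -->
  \int[mu]_(z in fst @^-1` A) h z.2)%R.
Variable E : set (Om * borel X).
Hypothesis mE : measurable E.

(** Over [V i] the bundle avoids [U i] up to a [nu_ n]-null set for every [n]; integrating a
    continuous function positive exactly on [U i] passes this to [mu]. Conversely a point off [E],
    over a [w] with closed fibre, has a basic neighbourhood [U i] missing the fibre; then [w] lies
    in no [W (n, i)], hence in [V i]. So the complement of [E] is covered by countably many
    [mu]-null sets. *)
Lemma limit_support : {ae P, forall w, closed [set x : X | E (w, x)]} ->
  (forall n, nu_ n E = 1) -> mu E = 1.
Proof.
move=> [N [mN PN EN]] nuE.
have nuCE n : nu_ n (~` E) = 0 by rewrite probability_setC// nuE subee.
have [U [oU Ubase]] := compact_open_sequence X_compact.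
have mU i : measurable (U i : set (borel X)) by apply: sub_sigma_algebra; exact: oU.
have msU i := @measurable_snd_preimage _ _ Om _ _ (mU i).
have mEU i := measurableI _ _ mE (msU i).
have /choice[W WP] : forall ni : nat * nat, exists W : set Om,
    [/\ measurable W, forall w, W w -> exists x, (E `&` snd @^-1` U ni.2) (w, x) &
      nu_ ni.1 ((E `&` snd @^-1` U ni.2) `\` fst @^-1` W) = 0].
  move=> ni; exact: (marginal_fibred P_lebesgue X_compact (nu_P ni.1) (mEU ni.2)).
pose V i := ~` \bigcup_n W (n, i).
have mV i : measurable (V i).
  by apply: measurableC; apply: bigcupT_measurable => n; case: (WP (n, i)).
have mfV i := @measurable_fst_preimage _ _ _ (borel X) _ (mV i).
have nuVU n i : nu_ n (fst @^-1` V i `&` snd @^-1` U i) = 0.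
  have [mW _ nuW] := WP (n, i).
  have mfW := @measurable_fst_preimage _ _ _ (borel X) _ mW.
  apply: (@subset_measure0 _ _ _ (nu_ n) _
    (~` E `|` ((E `&` snd @^-1` U i) `\` fst @^-1` W (n, i)))).
  - exact: measurableI.
  - by apply: measurableU; [exact: measurableC|exact: measurableD].
  - move=> z [Vz Uz]; have [Ez|nEz] := pselect (E z); last by left.
    by right; split=> // Wz; apply: Vz; exists n.
  - apply/eqP; rewrite -measure_le0.
    have <- : nu_ n (~` E) + nu_ n ((E `&` snd @^-1` U i) `\` fst @^-1` W (n, i)) = 0.
      by rewrite nuCE nuW adde0.
    by apply: measureU2; [exact: measurableC|exact: measurableD].
have muVU i : mu (fst @^-1` V i `&` snd @^-1` U i) = 0.
  have [g [cg g01 gU]] := closed_zero_set (open_closedC (oU i)).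
  have mg := continuous_borel_measurable cg.
  have mgs (m : probability (Om * borel X)%type R) :
      measurable_fun (fst @^-1` V i) (fun z : Om * borel X => (g z.2)%:E).
    by apply: measurable_funTS; apply/measurable_EFinP; exact: measurableT_comp mg measurable_snd.
  have gpos (z : Om * borel X) : U i z.2 -> (0 < g z.2)%R.
    move=> Uz; rewrite lt_neqAle; case/andP: (g01 z.2) => -> _; rewrite andbT.
    by apply/negP => /eqP/esym gz; exact: (gU z.2).1 gz Uz.
  have g0 (z : Om * borel X) : ~ U i z.2 -> g z.2 = 0%R by move=> nUz; apply: (gU z.2).2.
  have nu0 n : (\int[nu_ n]_(z in fst @^-1` V i) g z.2)%R = 0%R.
    rewrite /Rintegral (_ : \int[_]_(z in _) _ = 0)//.
    rewrite (_ : fst @^-1` V i = (fst @^-1` V i `&` snd @^-1` U i) `|`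
        (fst @^-1` V i `\` snd @^-1` U i)); last by rewrite setUIDK.
    have mVU := measurableI _ _ (mfV i) (msU i).
    have mVD := measurableD (mfV i) (msU i).
    rewrite ge0_integral_setU//; last 3 first.
    - by rewrite setUIDK; exact: mgs.
    - by move=> z _; rewrite lee_fin; case/andP: (g01 z.2).
    - by apply/disj_setPS => z [[_ Uz] [_ nUz]].
    have mgVU : measurable_fun (fst @^-1` V i `&` snd @^-1` U i : set (Om * borel X))
        (fun z : Om * borel X => (g z.2)%:E).
      by apply: (measurable_funS (mfV i)) (mgs (nu_ n)) => z [].
    rewrite (null_set_integral mVU mgVU (nuVU n i)).
    by rewrite add0e integral0_eq// => z [_ /g0 ->].
  have mu0 : (\int[mu]_(z in fst @^-1` V i) g z.2)%R = 0%R.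
    apply: (cvg_unique _ (nu_mu (mV i) cg)) => //.
    by rewrite (funext nu0); exact: cvg_cst.
  have gint : mu.-integrable (fst @^-1` V i) (fun z => (g z.2)%:E).
    apply: measurable_bounded_integrable => //.
    - exact: le_lt_trans (probability_le1 mu (mfV i)) (ltry _).
    - by apply/measurable_EFinP; exact: mgs.
    exists 1%R; split=> // M /ltW M1 z _ /=; apply: le_trans M1.
    by case/andP: (g01 z.2) => ? ?; rewrite ger0_norm.
  have mu0' : \int[mu]_(z in fst @^-1` V i) `|(g z.2)%:E| = 0.
    rewrite -[RHS](congr1 EFin mu0) /Rintegral fineK; last exact: integrable_fin_num.
    apply: eq_integral => z _; rewrite gee0_abs// lee_fin.
    by case/andP: (g01 z.2).
  have [N' [mN' muN' gN']] := (ae_eq_integral_abs mu (mfV i) (mgs mu)).1 mu0'.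
  apply: (@subset_measure0 _ _ _ mu _ N') => //; first exact: measurableI.
  move=> z [Vz Uz]; apply: gN' => /(_ Vz) [gz].
  by have := gpos _ Uz; rewrite gz ltxx.
have mCE : measurable (~` E) by exact: measurableC.
have muCE : mu (~` E) = 0.
  have mfN := @measurable_fst_preimage _ _ _ (borel X) _ mN.
  have : mu.-negligible (fst @^-1` N `|` \bigcup_i (fst @^-1` V i `&` snd @^-1` U i)).
    apply: negligibleU.
      by exists (fst @^-1` N); split=> //; exact: marginal_setC_eq0 mu_P _ _ _.
    apply: negligible_bigcup => i; exists (fst @^-1` V i `&` snd @^-1` U i).
    by split; [exact: measurableI (mfV i) (msU i)|exact: muVU|].
  move=> muN0; apply: (measure_negligible mCE); move: muN0.
  apply: negligibleS => -[w x] nEz.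
  have [Nw|nNw] := pselect (N w); first by left.
  have cEw : closed [set x : X | E (w, x)] by apply: contrapT => h; apply: nNw; exact: EN.
  have [|i [Ux UE]] := Ubase x (~` [set x : X | E (w, x)]).
    by apply: open_nbhs_nbhs; split=> //; exact: closed_openC.
  right; exists i => //; split=> //=.
  move=> [n _ Wn]; have [_ /(_ w Wn)[y [Ey Uy]] _] := WP (n, i).
  exact: UE Uy Ey.
have := probability_setC mu mCE; rewrite setCK => ->.
by rewrite muCE sube0.
Qed.

End support.

(* Averages, with rational weights, of tent functions centred at the points of
   finite nets; the restriction to compact subsets dispenses with Tietze. *)
Lemma countable_uniform_approximation (R : realType) (X : pmetricType R) :
  compact [set: X] -> exists h : nat -> X -> R, (forall i, continuous (h i)) /\
    forall K f e, compact K -> {within K, continuous f} -> 0 < e ->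
      exists i, forall x, K x -> `|f x - h i x| <= e.
Proof.
move=> /finite_net[t tP].
pose r n : R := n.+1%:R^-1.
pose phi n k x : R := Num.max 0 (r n - mdist (nth point (t n) k) x).
pose S n x := \sum_(k < size (t n)) phi n k x.
pose h (i : nat) x := if @choice.unpickle (nat * seq rat)%type i is Some (n, q)
  then (\sum_(k < size (t n)) ratr (nth 0 q k) * phi n k x) / S n x else 0.
have phi0 n k x : 0 <= phi n k x by rewrite /phi le_max lexx.
have cphi n k : continuous (phi n k).
  have cdist (y : X) : continuous (mdist y).
    move=> x; apply/cvgrPdist_lt => e e0; apply/nbhs_ballP; exists e => // z.
    rewrite ballEmdist /= => xz; apply: le_lt_trans xz.
    have := metric_triangle y x z; have := metric_triangle y z x.
    by rewrite ler_norml (metric_sym z x); lra.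
  move=> x; apply: (@continuous_max _ _ (cst 0) (fun x => r n - mdist (nth point (t n) k) x)).
    exact: cst_continuous.
  by apply: cvgB; [exact: cvg_cst|exact: cdist].
have S_gt0 n x : 0 < S n x.
  have [y yt yx] := tP n x; have kt : (index y (t n) < size (t n))%N by rewrite index_mem.
  rewrite /S (bigD1 (Ordinal kt))//= ltr_pwDl//; last exact: sumr_ge0.
  by rewrite /phi lt_max nth_index// subr_gt0 yx orbT.
exists h; split=> [i x|K f e cK cf e0].
  rewrite /h; case: choice.unpickle => [[n q]|]; last exact: cvg_cst.
  apply: cvgM; last apply: cvgV.
  - apply: cvg_big => [|k _]; first exact: add_continuous.
    by apply: cvgM; [exact: cvg_cst|exact: cphi].
  - by rewrite gt_eqF.
  - apply: cvg_big => [|k _]; first exact: add_continuous.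
    exact: cphi.
have e2 : 0 < e / 2 by rewrite divr_gt0.
have [s s0 fs] := compact_uniform_continuity cK cf e2.
pose n := Num.truncn (2 / s).
have ns : r n < s / 2.
  by rewrite -[ltRHS]invf_div ltf_pV2 ?posrE ?divr_gt0// truncnS_gt.
(* The [k]-th weight is a rational close to the value of [f] at some point of [K] under the [k]-th
   tent; it is arbitrary when the tent misses [K]. *)
have /choice[q qP] : forall k, exists q : rat, forall y,
    K y -> mdist (nth point (t n) k) y < r n -> `|f y - ratr q| <= e.
  move=> k; have [[y [Ky ky]]|/forallNP nK] :=
      pselect (exists y, K y /\ mdist (nth point (t n) k) y < r n); last first.
    by exists 0 => y Ky ky; exfalso; exact: (nK y).
  have yy : f y < f y + e / 2 by rewrite ltrDl.
  have [q] := rat_in_itvoo yy; rewrite in_itv/= => /andP[q1 q2].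
  exists q => z Kz kz.
  have : `|f z - f y| < e / 2.
    apply: fs => //; rewrite (le_lt_trans (metric_triangle _ (nth point (t n) k) _))//.
    by rewrite (splitr s) metric_sym ltrD// (lt_trans _ ns).
  rewrite ltr_norml ler_norml; lra.
exists (choice.pickle (n, mkseq q (size (t n)))) => x Kx.
rewrite /h choice.pickleK.
have Sx := S_gt0 n x.
rewrite -[f x](mulfK (lt0r_neq0 Sx)) -mulrBl normrM [X in _ * X]ger0_norm ?invr_ge0 ?(ltW Sx)//.
rewrite ler_pdivrMr// /S !mulr_sumr -sumrB (le_trans (ler_norm_sum _ _ _))//.
apply: ler_sum => k _; rewrite nth_mkseq// -mulrBl normrM (ger0_norm (phi0 _ _ _)).
have [xk|kx] := ltP (mdist (nth point (t n) k) x) (r n).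
  by apply: ler_wpM2r => //; exact: qP.
by rewrite (_ : phi n k x = 0) ?mulr0// /phi max_l// subr_le0.
Qed.

Section convergence.
Context (R : realType) d (Om : measurableType d) (P : probability Om R).
Context (X : pmetricType R).
Hypothesis P_lebesgue : lebesgue_space P.
Hypothesis X_compact : compact [set: X].
Variables (nu_ : nat -> probability (Om * borel X)%type R)
  (mu : probability (Om * borel X)%type R).
Hypothesis nu_P : forall n, marginal P (nu_ n).
Hypothesis mu_P : marginal P mu.
Hypothesis nu_mu : forall A h, measurable A -> continuous h ->
  (fun j => \int[nu_ j]_(z in fst @^-1` A) h z.2) @ \oo -->
  \int[mu]_(z in fst @^-1` A) h z.2.
Variable E : set (Om * borel X).
Hypothesis mE : measurable E.
Hypothesis nuE : forall n, nu_ n E = 1%E.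
Hypothesis muE : mu E = 1%E.

Lemma cvg_integral_tail (k : Om -> R) (T : (set Om)^nat) :
  (forall n, measurable (T n)) -> P.-integrable setT (EFin \o k) ->
  (forall w, 0 <= k w) -> (forall w, \forall n \near \oo, ~ T n w) ->
  (fun n => \int[P]_w (k w * \1_(T n) w)%:E)%E @ \oo --> 0%E.
Proof.
move=> mT ik k0 T0.
have mk : measurable_fun setT k by apply/measurable_EFinP; exact: measurable_int ik.
rewrite -[X in _ --> X](integral0 P setT).
apply: (@dominated_cvg _ _ _ _ _ _ _ _ (EFin \o k)) => //.
- by move=> n; apply/measurable_EFinP; exact: measurable_funM.
- move=> w _; apply: cvg_near_cst; apply: filterS (T0 w) => n nT.
  by rewrite indicE memNset// mulr0.
- move=> n w _; rewrite /= lee_fin normrM !ger0_norm// ler_piMr// indicE.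
Qed.

(** The base is cut into countably many pieces [A i], over each of which a single continuous [h i]
    is close to [f]. Integrability of [k] makes all but finitely many pieces negligible, uniformly
    in the measure since all have marginal [P], and a finite sum of products of indicators and
    continuous functions is left. *)
Lemma random_measure_cvg (f : Om * borel X -> R) (k : Om -> R) :
  measurable_fun E f -> P.-integrable setT (EFin \o k) -> (forall w, 0 <= k w) ->
  {ae P, forall w, [/\ compact [set x : X | E (w, x)],
    {within [set x : X | E (w, x)], continuous (fun x : X => f (w, x))} &
    forall x, E (w, x) -> `|f (w, x)| <= k w]} ->
  (fun n => \int[nu_ n]_(z in E) f z) @ \oo --> \int[mu]_(z in E) f z.
Proof.
move=> mf ik k0 [N0 [mN0 PN0 Egood]].
have [h [ch happrox]] := countable_uniform_approximation X_compact.
have mh i : measurable_fun setT (fun z : Om * borel X => h i z.2).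
  by apply: measurableT_comp measurable_snd; exact: continuous_borel_measurable.
(* The limit is put at index 0, so that the same pieces and the same bound [close] serve for [mu]
   and for every [nu_ n]. *)
pose m n := if n is n'.+1 then nu_ n' else mu.
have mP n : marginal P (m n) by case: n.
have mE1 n : m n E = 1%E by case: n.
apply: cvgn_approx => e0 e0_gt0; pose e := e0 / 2.
have e_gt0 : 0 < e by rewrite divr_gt0.
pose S i := E `&` (fun z => `|f z - h i z.2|) @^-1` `]e, +oo[%classic.
have mS i : measurable (S i).
  have mfh : measurable_fun E (fun z => `|f z - h i z.2|).
    apply: measurableT_comp => //; apply: measurable_funB => //.
    exact: measurable_funTS.
  by apply: mfh => //; exact: measurable_itv.
have /choice[W WP] : forall ni : nat * nat, exists W : set Om,
    [/\ measurable W, forall w, W w -> exists x, (S ni.2) (w, x) &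
      m ni.1 (S ni.2 `\` fst @^-1` W) = 0%E].
  by move=> ni; exact: (marginal_fibred P_lebesgue X_compact (mP ni.1) (mS ni.2)).
have mW ni : measurable (W ni) by case: (WP ni).
(* Over [V i], [f] and [h i] differ by more than [e] only on a set null for every [m n]. Conversely
   [V i] contains each [w] on whose whole fibre they differ by at most [e], so the sets [V i] cover
   almost all of [Om]. *)
pose V i := ~` \bigcup_n W (n, i).
have mV i : measurable (V i).
  by apply: measurableC; apply: bigcupT_measurable => n.
pose A := seqDU V.
have mA i : measurable (A i) by exact: seqDU_measurable.
have trivA : trivIset setT A by exact: trivIset_seqDU.
pose T n := ~` (\bigcup_(i < n) A i) `\` N0.
have mT n : measurable (T n).
  by apply: measurableD => //; apply: measurableC; exact: bigcup_measurable.
have TE w : \forall n \near \oo, ~ T n w.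
  have [Nw|nNw] := pselect (N0 w); first by near=> n; move=> [].
  have [cEw cfw _] : [/\ compact [set x : X | E (w, x)],
    {within [set x : X | E (w, x)], continuous (fun x : X => f (w, x))} &
    forall x, E (w, x) -> `|f (w, x)| <= k w].
    by apply: contrapT => nw; apply: nNw; exact: Egood.
  have [i hi] := happrox _ _ _ cEw cfw e_gt0.
  have Vi : V i w.
    move=> [n _ Wn]; have [_ /(_ w Wn)[x [Ex fx]] _] := WP (n, i).
    by move: fx; rewrite /= in_itv/= andbT ltNge => /negP; apply; exact: hi.
  have : (\bigcup_i A i) w by rewrite -seqDU_bigcup_eq; exists i.
  move=> [j _ Aj]; near=> n; move=> [nA _]; apply: nA; exists j => //=.
  by near: n; exact: nbhs_infty_gt.
have /fine_cvgP[_ /cvgrPdist_le/(_ _ e_gt0)[n0 _ /(_ n0 (leqnn _))/=]] :=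
  cvg_integral_tail mT ik k0 TE.
rewrite sub0r normrN => kT.
have close n : `|\int[m n]_(z in E) f z -
    \sum_(i < n0) \int[m n]_(z in fst @^-1` (A i)) h i z.2| <= e0.
  have mfA i := @measurable_fst_preimage _ _ _ (borel X) _ (mA i).
  pose g z := \sum_(i < n0) ((fun z => h i z.2) \_ (fst @^-1` (A i))) z.
  have ih i : (m n).-integrable setT
      (EFin \o ((fun z => h i z.2) \_ (fst @^-1` (A i)))).
    have [M hM] := continuous_bounded X_compact (ch i).
    apply: measurable_bounded_integrable => //.
    - exact: le_lt_trans (probability_le1 (m n) measurableT) (ltry _).
    - by apply/(measurable_restrictT _ (mfA i)); exact: measurable_funTS.
    exists M; split; first exact: num_real.
    move=> N /ltW MN z _ /=; apply: le_trans MN; rewrite patchE.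
    by case: ifP => _ //; rewrite normr0 (le_trans _ (hM z.2)).
  have ig : (m n).-integrable setT (EFin \o g).
    rewrite (_ : EFin \o g = fun z => \sum_(i < n0)
        (EFin \o ((fun z => h i z.2) \_ (fst @^-1` (A i)))) z)%E.
      exact: integrable_sum.
    by apply/funext => z /=; rewrite /g sumEFin.
  have gE : \sum_(i < n0) \int[m n]_(z in fst @^-1` (A i)) h i z.2 =
      \int[m n]_z g z.
    rewrite /Rintegral /g; under [in RHS]eq_integral do rewrite -sumEFin.
    rewrite [in RHS]integral_sum//; last by move=> i; exact: ih.
    rewrite -sum_fine => [|i _]; last exact: integrable_fin_num (ih i).
    by apply: eq_bigr => i _; rewrite -[LHS]/(Rintegral _ _ _) Rintegral_mkcond.
  (* Once this [m n]-null set is removed, the domination by [k] and the closeness of [f] to [h i]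
     over [A i] hold at every remaining point of [E]. *)
  pose Z := fst @^-1` N0 `|` \bigcup_i (S i `\` fst @^-1` (W (n, i))).
  have mfN0 := @measurable_fst_preimage _ _ _ (borel X) _ mN0.
  have mSW i : measurable (S i `\` fst @^-1` (W (n, i))).
    by apply: measurableD => //; exact: measurable_fst_preimage.
  have mZ : measurable Z.
    by apply: measurableU => //; exact: bigcupT_measurable.
  pose E' := E `\` Z.
  have mE' : measurable E' by exact: measurableD.
  have mCE' : measurable (~` E') by exact: measurableC.
  have E'0 : m n (~` E') = 0%E.
    apply: measure_negligible => //.
    apply: (@negligibleS _ _ _ _ (~` E `|` Z)).
      by move=> z nE'; have [Ez|nEz] := pselect (E z); [right|left];
        [apply: contrapT => nZ; apply: nE'|].
    have null B : measurable B -> m n B = 0%E -> (m n).-negligible B.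
      by move=> mB B0; exists B; split.
    apply: negligibleU.
      have mCE : measurable (~` E) by exact: measurableC.
      have CE0 : m n (~` E) = 0%E by rewrite probability_setC// mE1 subee.
      exact: null.
    apply: negligibleU.
      by apply: null => //; exact: (marginal_setC_eq0 (mP n)).
    by apply: negligible_bigcup => i; apply: null => //; case: (WP (n, i)).
  have fk z : E' z -> `|f z| <= k z.1.
    case: z => w x [Ez nZ].
    have [_ _] : [/\ compact [set x : X | E (w, x)],
      {within [set x : X | E (w, x)], continuous (fun x : X => f (w, x))} &
      forall x, E (w, x) -> `|f (w, x)| <= k w].
      by apply: contrapT => nw; apply: nZ; left; exact: Egood.
    by apply.
  have ifE' : (m n).-integrable E' (EFin \o f).
    apply: (marginal_integrable (mP n) mE' _ ik fk).
    by apply: measurable_funS mf => //; exact: subDsetl.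
  have igE' : (m n).-integrable E' (EFin \o g).
    exact: integrableS ig.
  have -> : \int[m n]_(z in E) f z = \int[m n]_(z in E') f z.
    congr fine; have <- : E `&` E' = E' by apply/setIidPr; exact: subDsetl.
    rewrite integral_mkcondr; apply: ae_eq_integral => //.
    - exact/measurable_EFinP.
    - apply/(measurable_restrict _ mE' mE).
      apply/measurable_EFinP; apply: measurable_funS mf => //.
    exists (~` E'); split=> // z nfz E'z; apply: nfz => Ez.
    by rewrite patchE mem_set.
  have -> : \sum_(i < n0) \int[m n]_(z in fst @^-1` (A i)) h i z.2 =
      \int[m n]_(z in E') g z.
    rewrite gE /Rintegral (negligible_integral mCE' measurableT ig E'0).
    by rewrite setTD setCK.
  rewrite -lee_fin.
  have mk : measurable_fun setT k by apply/measurable_EFinP; exact: measurable_int ik.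
  have mkT : measurable_fun setT (fun w => k w * \1_(T n0) w).
    by apply: measurable_funM => //; exact: measurable_indic.
  apply: le_trans (Rintegral_dist_le (k := fun w => (e%:E + (k w * \1_(T n0) w)%:E)%E)
    (mP n) mE' ifE' igE' _ _ _) _.
  - by apply: emeasurable_funD => //; exact/measurable_EFinP.
  - by move=> w; rewrite adde_ge0// lee_fin ?mulr_ge0// ltW.
  - move=> z E'z; rewrite -EFinD lee_fin; have kz := fk z E'z.
    case: z E'z kz => w x [Ez nZ] /= kz.
    have [[i [/= iN Ai]]|/forallNP nA] := pselect (exists i, (i < n0)%N /\ A i w).
      have -> : g (w, x) = h i x.
        rewrite /g (bigD1 (Ordinal iN))//= patchE mem_set// big1 ?addr0// => j ji.
        rewrite patchE memNset// => Aj; move/eqP: ji; apply; apply/val_inj => /=.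
        by apply: (trivA j i) => //; exists w.
      apply: (@le_trans _ _ e); last by rewrite lerDl mulr_ge0.
      rewrite leNgt; apply/negP => fh; apply: nZ; right; exists i => //.
      split; first by split=> //=; rewrite in_itv/= fh.
      by move=> Wi; case: Ai => Vi _; apply: Vi; exists n.
    have -> : g (w, x) = 0.
      rewrite /g big1// => j _; rewrite patchE memNset// => Aj.
      by apply: (nA j); split=> //; exact: ltn_ord.
    rewrite subr0 indicE mem_set ?mulr1; first by rewrite (le_trans kz)// lerDr ltW.
    split; last by move=> Nw; apply: nZ; left.
    by move=> [i /= iN Ai]; apply: (nA i).
  rewrite ge0_integralD//; last 3 first.
  - by move=> w _; rewrite lee_fin ltW.
  - by move=> w _; rewrite lee_fin mulr_ge0.
  - exact/measurable_EFinP.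
  rewrite integral_cst// [X in (_ * X)%E]probability_setT mule1.
  have Tfin : (\int[P]_w (k w * \1_(T n0) w)%:E)%E \is a fin_num.
    apply: integrable_fin_num => //; apply: le_integrable ik => //.
      exact/measurable_EFinP.
    move=> w _; rewrite /= lee_fin normrM ler_piMr// indicE.
    by case: (_ \in _); rewrite ?normr1 ?normr0.
  rewrite -(fineK Tfin) -EFinD lee_fin (splitr e0) lerD2l.
  exact: le_trans (ler_norm _) kT.
exists (fun n => \sum_(i < n0) \int[nu_ n]_(z in fst @^-1` (A i)) h i z.2).
exists (\sum_(i < n0) \int[mu]_(z in fst @^-1` (A i)) h i z.2); split.
- by apply: cvg_big => [|i _]; [exact: add_continuous|exact: nu_mu].
- by move=> n; exact: (close n.+1).
- exact: (close 0%N).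
Unshelve. all: by end_near. Qed.

End convergence.

(** * Functions dominated by an integrable function of the base point *)

Section dynamics.
Context (R : realType) (G : groupType) d (Om : measurableType d).
Context (P : probability Om R) (T : mp_action G P) (X : pmetricType R).
Variable F : bundle_rds T X.
Local Notation E := (bundle F).
Local Notation skew := Defs.skew.
Local Notation fmap := Defs.fmap.
Local Notation Y := (Om * borel X)%type.
Implicit Types (nu : probability Y R) (f : Y -> R) (k : Om -> R).

Lemma prob_bundle_marginal nu : prob_bundle F nu -> marginal P nu.
Proof. by case. Qed.

Lemma skewE g w x : E (w, x) -> skew F g (w, x) = (T g w, fmap F g w x).
Proof. by move=> Ewx; rewrite /skew /patch mem_set. Qed.

Lemma skew_bundle g z : E z -> E (skew F g z).
Proof. by case: z => w x Ez; rewrite skewE//; exact: fmap_bundle. Qed.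

Lemma skewM g h z : E z -> skew F g (skew F h z) = skew F (g * h)%g z.
Proof.
case: z => w x Ez; have Ehz : E (T h w, fmap F h w x) by exact: fmap_bundle.
by rewrite (skewE h Ez) (skewE g Ehz) (skewE _ Ez) fmapM// actM.
Qed.

Lemma skew_preimage_bundle g : skew F g @^-1` E = E.
Proof.
apply/seteqP; split=> z /=; last exact: skew_bundle.
by rewrite {1}/skew /patch; case: ifPn => [/set_mem|].
Qed.

Lemma ae_act g (Q : Om -> Prop) : {ae P, forall w, Q w} ->
  {ae P, forall w, Q (T g w)}.
Proof.
move=> [N [mN PN QN]]; exists (T g @^-1` N); split.
- by rewrite -[X in measurable X]setTI; exact: measurable_act.
- by rewrite act_preserving.
- by move=> w nQ; exact: QN.
Qed.

Lemma integral_act g (k : Om -> \bar R) : measurable_fun setT k ->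
  (forall w, 0 <= k w)%E -> (\int[P]_w k (T g w) = \int[P]_w k w)%E.
Proof.
move=> mk k0.
have mT : measurable_fun setT (T g) by exact: measurable_act.
have := @ge0_integral_pushforward _ _ _ _ R (T g) mT P setT k
  measurableT mk (fun w _ => k0 w).
rewrite preimage_setT => <-; apply: eq_measure_integral => A mA _.
exact: (act_preserving T g mA).
Qed.

(** A form of the integrability in [L1_bundle] that is stable under [skew], sums and absolute
    values: with an explicit bound [k], no supremum over a fibre has to be shown measurable. *)
Definition dominated f k : Prop :=
  [/\ measurable_fun E f, P.-integrable setT (EFin \o k), forall w, 0 <= k w &
    {ae P, forall w x, E (w, x) -> `|f (w, x)| <= k w}].

(** Only almost everywhere, since the maps [fmap F g w] are continuous for almost every [w] and the
    class must be stable under composition with [skew]. *)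
Definition fibre_continuous f : Prop :=
  {ae P, forall w, {within fibre F w, continuous (fun x : X => f (w, x))}}.

Lemma L1_bundle_dominated f : L1_bundle F f -> exists k, dominated f k.
Proof.
move=> [mf _ si].
pose s w := ereal_sup [set (`|f (w, x)|)%:E | x in fibre F w].
(* [fine] sends both infinities to 0: [s w] is [+oo] only for [w] in a null set, and [-oo] only when
   the fibre is empty. *)
exists (fun w => fine (s w)); split => //.
- apply: (le_integrable measurableT _ _ si) => //.
    by apply/measurable_EFinP; apply: measurableT_comp => //; exact: measurable_int si.
  move=> w _ /=; rewrite -/(s w); case: (s w) => [r||] /=; by rewrite ?lexx ?leey.
- move=> w; have [[x Ex]|/forallNP nE] := pselect (exists x, fibre F w x).
    apply: fine_ge0; apply: (@le_trans _ _ (`|f (w, x)|)%:E); first by rewrite lee_fin.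
    by apply: ereal_sup_ubound; exists x.
  have s0 : [set (`|f (w, x)|)%:E | x in fibre F w] = set0.
    by apply/seteqP; split=> // r [x /nE].
  by rewrite /s s0 ereal_sup0.
have := integrable_ae measurableT si; apply: filterS => w /(_ I) sfin x Ex.
by rewrite -lee_fin fineK//; apply: ereal_sup_ubound; exists x.
Qed.

Lemma L1_bundle_fibre_continuous f : L1_bundle F f -> fibre_continuous f.
Proof. by move=> [_ cf _]; apply: aeW. Qed.

Lemma measurable_skew_comp g f : measurable_fun E f ->
  measurable_fun E (f \o skew F g).
Proof.
move=> mf; apply: (measurable_comp (measurable_bundle F)) mf _.
  by move=> _ [z Ez <-]; exact: skew_bundle.
by apply: measurable_funTS; exact: measurable_skew.
Qed.

Lemma dominated_skew g f k : dominated f k ->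
  dominated (f \o skew F g) (k \o T g).
Proof.
move=> [mf ik k0 fk]; split.
- exact: measurable_skew_comp.
- have mk : measurable_fun setT (fun w => `|(k w)%:E|%E).
    by apply: measurableT_comp => //; exact: measurable_int ik.
  apply/integrableP; split.
    by apply: (measurableT_comp (measurable_int _ ik)); exact: measurable_act.
  rewrite (integral_act g mk)//.
  by case/integrableP: ik.
- by move=> w; exact: k0.
apply: filterS (ae_act g fk) => w kw x Ex.
rewrite /= skewE//; apply: kw; exact: fmap_bundle.
Qed.

Lemma fibre_continuous_skew g f : fibre_continuous f ->
  fibre_continuous (f \o skew F g).
Proof.
move=> cf; have := bundle_ae F; have := ae_act g cf.
apply: filterS2 => w cfw /= [_ _ /(_ g) cF].
apply/subspace_continuousP => x Ex.
have cF' := (subspace_continuousP _ _).1 cF x Ex.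
have cf' := (subspace_continuousP _ _).1 cfw (fmap F g w x) (fmap_bundle g Ex).
have fE : (fun y : X => f (skew F g (w, y))) x = f (T g w, fmap F g w x).
  by rewrite skewE.
rewrite [X in _ --> X]fE.
have Fcvg : fmap F g w y @[y --> within (fibre F w) (nbhs x)] -->
    within (fibre F (T g w)) (nbhs (fmap F g w x)).
  move=> V VF; have := cF' _ VF; rewrite /nbhs/= /within/= /from_subspace.
  apply: filterS => y h Ey; apply: h => //.
  exact: fmap_bundle.
have := cvg_comp _ _ Fcvg cf'.
apply: cvg_trans; apply: near_eq_cvg; rewrite near_withinE.
by apply: nearW => y Ey; rewrite /from_subspace/= skewE.
Qed.

End dynamics.

Lemma marginal_ae (R : realType) d (Om : measurableType d)
    (P : probability Om R) (X : pmetricType R)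
    (m : probability (Om * borel X)%type R) (Q : Om -> Prop) : marginal P m ->
  {ae P, forall w, Q w} -> {ae m, forall z, Q z.1}.
Proof.
move=> mP [N [mN PN QN]]; exists (fst @^-1` N); split.
- exact: measurable_fst_preimage.
- by rewrite mP.
- by move=> z nQ; exact: QN.
Qed.

(** * Integrals against translated and averaged measures *)

Section averages.
Context (R : realType) (G : groupType) d (Om : measurableType d).
Context (P : probability Om R) (T : mp_action G P) (X : pmetricType R).
Variable F : bundle_rds T X.
Local Notation E := (bundle F).
Local Notation skew := Defs.skew.
Local Notation fmap := Defs.fmap.
Local Notation Y := (Om * borel X)%type.
Implicit Types (nu : probability Y R) (f : Y -> R) (k : Om -> R).

Let mE : measurable E := measurable_bundle F.

Lemma dominated_integrable nu f k : marginal P nu -> dominated F f k ->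
  nu.-integrable E (EFin \o f).
Proof.
move=> nuP [mf ik k0 fk].
have mk : measurable_fun setT (fun w => (k w)%:E) by exact: measurable_int ik.
have mk1 : measurable_fun setT (fun z : Y => (k z.1)%:E).
  exact: measurableT_comp mk measurable_fst.
have kfin : (\int[P]_w (k w)%:E < +oo)%E.
  case/integrableP: ik => _; apply: le_lt_trans; apply: ge0_le_integral => //=.
  - by move=> w _; rewrite lee_fin.
  - apply/measurable_EFinP; apply: measurableT_comp => //.
    by apply/measurable_EFinP; exact: mk.
  - by move=> w _; rewrite lee_fin ler_norm.
apply/integrableP; split; first exact/measurable_EFinP.
apply: le_lt_trans kfin.
rewrite -(marginal_integral nuP mk); last by move=> w; rewrite lee_fin.
apply: (@le_trans _ _ (\int[nu]_(z in E) (k z.1)%:E)%E).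
  apply: ae_ge0_le_integral => //.
  - by apply: measurableT_comp => //; exact/measurable_EFinP.
  - by move=> z _; rewrite lee_fin.
  - exact: measurable_funTS.
  have := marginal_ae nuP fk; apply: filterS => -[w x] /= h Ez.
  by rewrite lee_fin; exact: h.
by apply: ge0_subset_integral => // z _; rewrite lee_fin.
Qed.

Lemma dominated_Rintegral_le nu f k : marginal P nu -> dominated F f k ->
  `|\int[nu]_(z in E) f z| <= \int[P]_w k w.
Proof.
move=> nuP fk; have ifE := dominated_integrable nuP fk.
case: fk => mf ik k0 fk.
have mk : measurable_fun setT (fun w => (k w)%:E) by exact: measurable_int ik.
rewrite (le_trans (le_normr_Rintegral mE ifE))//.
have iafE := integrable_abse ifE.
rewrite /Rintegral -lee_fin !fineK; last 2 first.
- exact: integrable_fin_num ik.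
- exact: integrable_fin_num iafE.
rewrite -(marginal_integral nuP mk); last by move=> w; rewrite lee_fin.
have mk1 : measurable_fun setT (fun z : Y => (k z.1)%:E).
  exact: measurableT_comp mk measurable_fst.
apply: (@le_trans _ _ (\int[nu]_(z in E) (k z.1)%:E)%E).
  apply: ae_ge0_le_integral => //.
  - by apply/measurable_EFinP; exact: measurableT_comp.
  - by move=> z _; rewrite lee_fin.
  - exact: measurable_funTS.
  have := marginal_ae nuP fk; apply: filterS => -[w x] /= h Ez.
  by rewrite lee_fin; exact: h.
by apply: ge0_subset_integral => // z _; rewrite lee_fin.
Qed.

Lemma dominated_norm f k : dominated F f k -> dominated F (fun z => `|f z|) k.
Proof.
move=> [mf ik k0 fk]; split=> //; first exact: measurableT_comp.
by apply: filterS fk => w h x Ex; rewrite normr_id; exact: h.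
Qed.

Lemma dominated_le_Rintegral nu f g kf kg : marginal P nu ->
  dominated F f kf -> dominated F g kg ->
  {ae P, forall w x, E (w, x) -> f (w, x) <= g (w, x)} ->
  \int[nu]_(z in E) f z <= \int[nu]_(z in E) g z.
Proof.
move=> nuP df dg [N [mN PN fgN]].
have mfN := @measurable_fst_preimage _ _ _ (borel X) _ mN.
have nuN := marginal_setC_eq0 nuP mN PN.
have i_f := dominated_integrable nuP df; have i_g := dominated_integrable nuP dg.
rewrite /Rintegral (negligible_integral mfN mE i_f nuN).
rewrite (negligible_integral mfN mE i_g nuN).
have mD : measurable (E `\` fst @^-1` N) by exact: measurableD.
have DE : E `\` fst @^-1` N `<=` E by exact: subDsetl.
apply: le_Rintegral => //; try exact: integrableS (mE) mD DE _.
move=> [w x] [Ez nN]; apply: contrapT => h; apply: nN; apply: fgN => /(_ x Ez).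
exact: h.
Qed.

Lemma ge0_integral_act_prob g nu f : measurable_fun E f ->
  (forall z, E z -> 0 <= f z) ->
  (\int[act_prob F g nu]_(z in E) (f z)%:E = \int[nu]_(z in E) (f (skew F g z))%:E)%E.
Proof.
move=> mf f0.
have mEf : measurable_fun E (EFin \o f) by exact/measurable_EFinP.
have := @ge0_integral_pushforward _ _ _ _ R (skew F g) (measurable_skew F g) nu E
  (EFin \o f) mE mEf.
rewrite skew_preimage_bundle; apply => z /set_mem Ez.
by rewrite lee_fin; exact: f0.
Qed.

Lemma ge0_integral_average (A : {fset G}) (A0 : A != fset0) nu f :
  measurable_fun E f -> (forall z, E z -> 0 <= f z) ->
  (\int[average F nu A0]_(z in E) (f z)%:E =
   (#|` A|%:R^-1)%:E * \sum_(g <- A) \int[nu]_(z in E) (f (skew F g z))%:E)%E.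
Proof.
move=> mf f0.
have mEf : measurable_fun E (EFin \o f) by exact/measurable_EFinP.
have c0 : 0 <= #|` A|%:R^-1 :> R by rewrite invr_ge0.
pose c : {nonneg R} := NngNum c0.
pose m_ (i : nat) : {measure set Y -> \bar R} := act_prob F (nth 1%g A i) nu.
have -> : (\int[average F nu A0]_(z in E) (f z)%:E =
    \int[mscale c (msum m_ #|` A|)]_(z in E) (f z)%:E)%E.
  apply: eq_measure_integral => B mB _.
  by rewrite /= /average /mscale /msum (big_nth 1%g) big_mkord.
rewrite ge0_integral_mscale//.
congr (_ * _)%E.
rewrite ge0_integral_measure_sum//.
rewrite [RHS](big_nth 1%g) big_mkord; apply: eq_bigr => i _.
exact: ge0_integral_act_prob.
Qed.

Lemma Rintegral_average (A : {fset G}) (A0 : A != fset0) nu f k :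
  marginal P nu -> dominated F f k ->
  \int[average F nu A0]_(z in E) f z =
  #|` A|%:R^-1 * \sum_(g <- A) \int[nu]_(z in E) f (skew F g z).
Proof.
move=> nuP df.
have key f' : dominated F f' k -> (forall z, E z -> 0 <= f' z) ->
    [/\ \int[average F nu A0]_(z in E) f' z =
      #|` A|%:R^-1 * \sum_(g <- A) \int[nu]_(z in E) f' (skew F g z) &
      (average F nu A0).-integrable E (EFin \o f')].
  move=> df' f0; have mf' : measurable_fun E f' by case: df'.
  have ig g : nu.-integrable E (fun z => (f' (skew F g z))%:E).
    exact: dominated_integrable nuP (dominated_skew g df').
  have IE : (\int[average F nu A0]_(z in E) (f' z)%:E =
      (#|` A|%:R^-1 * \sum_(g <- A) \int[nu]_(z in E) f' (skew F g z))%:E)%E.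
    rewrite ge0_integral_average// EFinM -sumEFin; congr (_ * _)%E.
    apply: eq_bigr => g _; rewrite fineK//.
    exact: integrable_fin_num (ig g).
  split; first by rewrite /Rintegral IE.
  apply/integrableP; split; first exact/measurable_EFinP.
  rewrite (eq_integral (fun z => (f' z)%:E)); first by rewrite IE ltry.
  by move=> z /set_mem Ez; rewrite /= ger0_norm// f0.
(* The formula is proved by [key] for non-negative functions, where sums of measures cause no
   integrability question, and extended by positive and negative parts. *)
pose fp z := Num.max (f z) 0; pose fn z := Num.max (- f z) 0.
have fE z : f z = fp z - fn z.
  rewrite /fp /fn; have [f0|f0] : 0 <= f z \/ f z <= 0 by apply/orP; exact: le_total.
    by rewrite max_l// max_r ?oppr_le0// subr0.
  by rewrite max_r// max_l ?oppr_ge0// sub0r opprK.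
have dfp : dominated F fp k.
  case: df => mf ik k0 fk; split=> //.
    by apply: measurable_maxr => //; exact: measurable_cst.
  apply: filterS fk => w h x Ex; have := h x Ex; rewrite /fp.
  by case: (lerP 0 (f (w, x))) => _; rewrite ?normr0.
have dfn : dominated F fn k.
  case: df => mf ik k0 fk; split=> //.
    apply: measurable_maxr; last exact: measurable_cst.
    exact: measurableT_comp.
  apply: filterS fk => w h x Ex; have := h x Ex; rewrite /fn.
  by case: (lerP 0 (- f (w, x))) => _; rewrite ?normr0// normrN.
have [|Ep ip] := key _ dfp; first by move=> z _; rewrite /fp le_max lexx orbT.
have [|En in_] := key _ dfn; first by move=> z _; rewrite /fn le_max lexx orbT.
transitivity (\int[average F nu A0]_(z in E) fp z - \int[average F nu A0]_(z in E) fn z).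
  by rewrite -RintegralB//; apply: eq_Rintegral => z _; rewrite fE.
rewrite Ep En -mulrBr -sumrB; congr (_ * _); apply: eq_bigr => g _.
rewrite -RintegralB//.
- by apply: eq_Rintegral => z _; rewrite -fE.
- exact: dominated_integrable nuP (dominated_skew g dfp).
- exact: dominated_integrable nuP (dominated_skew g dfn).
Qed.

Lemma act_prob_bundle g nu : prob_bundle F nu -> prob_bundle F (act_prob F g nu).
Proof.
move=> [nuP nuE]; split; last first.
  by rewrite /= /act_prob /pushforward skew_preimage_bundle.
move=> A mA; rewrite /= /act_prob /pushforward.
have mTA : measurable (T g @^-1` A).
  by rewrite -[X in measurable X]setTI; apply: measurable_act.
have nuCE : nu (~` E) = 0%E by rewrite probability_setC// nuE subee.
have mCE : measurable (~` E) by exact: measurableC.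
(* Off the bundle [skew] fixes the base point instead of moving it by [T g], so the two preimages of
   [A] agree only after intersection with [E], which carries [nu]. *)
have nuI B : measurable B -> nu B = nu (B `&` E).
  move=> mB; transitivity (nu (B `\` E) + nu (B `&` E))%E; first exact: measureDI.
  rewrite (@subset_measure0 _ _ _ nu (B `\` E) (~` E)) ?add0e//.
  exact: measurableD.
have mS : measurable (skew F g @^-1` (fst @^-1` A)).
  rewrite -[X in measurable X]setTI; apply: measurable_skew => //.
  exact: measurable_fst_preimage.
rewrite (nuI _ mS) -(act_preserving T g mA) -(nuP _ mTA) /pushforward.
rewrite [RHS]nuI; last exact: measurable_fst_preimage.
congr (nu _); apply/seteqP; split=> -[w x] [/=].
  by move=> + Ez; rewrite skewE.
by move=> Aw Ez; rewrite skewE.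
Qed.

Lemma average_prob_bundle (A : {fset G}) (A0 : A != fset0) nu :
  prob_bundle F nu -> prob_bundle F (average F nu A0).
Proof.
move=> nub; have A1 : (#|` A|%:R != 0 :> R) by rewrite pnatr_eq0 cardfs_eq0.
have cst_avg (r : R) (B : set Y) : (forall g, act_prob F g nu B = r%:E) ->
    average F nu A0 B = r%:E.
  move=> Br; rewrite /average (eq_bigr (fun=> r%:E)) => [|g _]; last exact: Br.
  rewrite sumEFin big_const_seq count_predT iter_addr_0 -EFinM.
  by rewrite -[r *+ _]mulr_natl mulrA mulVf ?mul1r.
split=> [B mB|].
  have PB : P B \is a fin_num by exact: fin_num_measure.
  rewrite /= /pushforward /= -(fineK PB); apply: cst_avg => g; rewrite fineK//.
  by have [h _] := act_prob_bundle g nub; exact: h.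
by apply: cst_avg => g; have [_] := act_prob_bundle g nub.
Qed.

End averages.

(** * Tilings and sub-additivity *)

Section fset_sums.
Context (R : realType) (G : choiceType).
Implicit Types (A B : {fset G}) (a : G -> R) (M : R).

Lemma sum_fset_filter A (p : pred G) a :
  \sum_(i <- A | p i) a i = \sum_(i <- [fset i in A | p i]%fset) a i.
Proof.
rewrite -[LHS]big_filter; apply: perm_big; apply: uniq_perm.
- by rewrite filter_uniq.
- exact: fset_uniq.
by move=> i; rewrite mem_filter !inE andbC.
Qed.

Lemma sum_fset_norm_le A (p : pred G) a M : (forall i, `|a i| <= M) ->
  `|\sum_(i <- A | p i) a i| <= M * #|` [fset i in A | p i]%fset|%:R.
Proof.
move=> aM; rewrite sum_fset_filter (le_trans (ler_norm_sum _ _ _))//.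
rewrite (le_trans (ler_sum _ (fun i _ => aM i)))//.
by rewrite big_const_seq count_predT iter_addr_0 mulr_natr.
Qed.

Lemma sum_symdiff_le A B a M : (forall i, `|a i| <= M) ->
  `|\sum_(i <- A) a i - \sum_(i <- B) a i| <=
  M * #|` ((A `\` B) `|` (B `\` A))%fset|%:R.
Proof.
move=> aM; rewrite (bigID (mem B))/= [X in _ - X](bigID (mem A))/=.
have -> : \sum_(i <- A | i \in B) a i = \sum_(i <- B | i \in A) a i.
  rewrite sum_fset_filter [RHS]sum_fset_filter.
  rewrite (_ : [fset i in A | i \in B]%fset = [fset i in B | i \in A]%fset)//.
  by apply/fsetP => i; rewrite !inE andbC.
rewrite opprD addrACA subrr add0r (le_trans (ler_normB _ _))//.
have -> : #|` ((A `\` B) `|` (B `\` A))%fset| =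
    (#|` [fset i in A | i \notin B]%fset| + #|` [fset i in B | i \notin A]%fset|)%N.
  rewrite -cardfsUI [X in (_ + #|` X|)%N](_ : _ = fset0) ?cardfs0 ?addn0.
    congr #|` _|; apply/fsetP => i; rewrite !inE.
    by case: (i \in A); case: (i \in B).
  by apply/fsetP => i; rewrite !inE; case: (i \in A); case: (i \in B).
by rewrite natrD mulrDr lerD// sum_fset_norm_le.
Qed.

End fset_sums.

Section translates.
Context (G : groupType).
Implicit Types (A B H : {fset G}) (g : G).

Lemma in_rtranslate A g x : (x \in rtranslate A g) = ((x * g^-1)%g \in A).
Proof.
apply/imfsetP/idP => [[h hA ->]|xA]; first by rewrite mulgK.
by exists (x * g^-1)%g; [exact: xA|rewrite mulgVK].
Qed.

Lemma rtranslate_neq0 A g : A != fset0 -> rtranslate A g != fset0.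
Proof.
by move=> /fset0Pn[h hA]; apply/fset0Pn; exists (h * g)%g; rewrite in_rtranslate mulgK.
Qed.

Lemma rtranslate1 g : rtranslate [fset 1%g]%fset g = [fset g]%fset.
Proof.
apply/fsetP => x; rewrite in_rtranslate !inE.
by apply/eqP/eqP => [/(congr1 (fun y => y * g)%g)|->]; rewrite ?mulgVK ?mul1g ?mulgV.
Qed.

Lemma sum_ltranslate (R : realType) A g (a : G -> R) :
  \sum_(h <- ltranslate g A) a h = \sum_(h <- A) a (g * h)%g.
Proof. by rewrite big_imfset//= => x y _ _; exact: mulgI. Qed.

(** With [c = f^-1 g], the point [g = f c] lies in the translate [A c], and [f' f^-1 g = f' c] is
    another point of it: these are the points of [H] lying in some translate of [A] that leaves
    [H]. *)
Definition exits A H : {fset G} :=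
  [fset g in H | has (fun f => has (fun f' => (f' * f^-1 * g)%g \notin H) A) A]%fset.

(** The points of [H] that [t] moves out of [H] inject into [t H] minus [H]. Only the finitely many
    [t = f' f^-1] occur, so the Folner property makes [exits A (Fn n)] a vanishing proportion of
    [Fn n]. *)
Lemma exits_card A H : (#|` exits A H| <=
  \sum_(f <- A) \sum_(f' <- A) #|` symdiff (ltranslate (f' * f^-1)%g H) H|)%N.
Proof.
have leave t : (\sum_(g <- H) ((t * g)%g \notin H) <=
    #|` symdiff (ltranslate t H) H|)%N.
  rewrite -big_mkcond/= sum1_count -size_filter.
  have -> : size [seq g <- H | (t * g)%g \notin H] =
      size [seq (t * g)%g | g <- H & (t * g)%g \notin H] by rewrite size_map.
  apply: uniq_leq_size.
    by rewrite map_inj_uniq; [exact: filter_uniq (fset_uniq _)|exact: mulgI].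
  move=> x /mapP[g gf xE]; rewrite {x}xE; move: gf.
  rewrite mem_filter => /andP[tgH gH].
  rewrite /symdiff in_fsetU in_fsetD tgH /=; apply/orP; left.
  by apply/imfsetP; exists g.
apply: (@leq_trans (\sum_(g <- H) \sum_(f <- A) \sum_(f' <- A)
    ((f' * f^-1 * g)%g \notin H))%N); last first.
  rewrite exchange_big/=; apply: leq_sum => f _.
  rewrite exchange_big/=; apply: leq_sum => f' _; exact: leave.
rewrite -sum1_size /= -[X in (X <= _)%N]/(\sum_(g <- exits A H) 1)%N.
have -> : (\sum_(g <- exits A H) 1 = \sum_(g <- H | has (fun f =>
    has (fun f' => (f' * f^-1 * g)%g \notin H) A) A) 1)%N.
  rewrite -[RHS]big_filter; apply: perm_big; apply: uniq_perm.
  - exact: fset_uniq.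
  - by rewrite filter_uniq.
  by move=> i; rewrite mem_filter !inE andbC.
rewrite big_mkcond/=; apply: leq_sum => g _.
case: ifP => // /hasP[f fA /hasP[f' f'A out]].
rewrite (big_rem f)//= (big_rem f')//= out.
by rewrite -addnA leq_addr.
Qed.

End translates.

Section tiling_bound.
Context (R : realType) (G : groupType).
Hypothesis G_abelian : forall g h : G, commute g h.
Variables (A : {fset G}) (delta : {fset G} -> R) (phi psi : G -> R).
Hypothesis A1 : 1%g \in A.
Hypothesis A_tiles : tiles A.
Hypothesis deltaA : forall c, delta (rtranslate A c) = phi c.
Hypothesis delta1 : forall c, delta [fset c]%fset = psi c.
Hypothesis delta_subA : forall B c, B != fset0 ->
  [disjoint B & rtranslate A c]%fset ->
  delta (B `|` rtranslate A c)%fset <= delta B + phi c.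
Hypothesis delta_sub1 : forall B c, B != fset0 ->
  [disjoint B & [fset c]]%fset -> delta (B `|` [fset c])%fset <= delta B + psi c.

(** Sub-additivity concerns non-empty sets only; the value 0 at the empty set lets a union be built
    up from nothing. *)
Let delta0 B := if B == fset0 then 0 else delta B.

Let A0 : A != fset0. Proof. by apply/fset0Pn; exists 1%g. Qed.

Lemma delta_big (S : G -> {fset G}) (v : G -> R) (l : seq G) B :
  (forall c, S c != fset0) -> (forall c, delta (S c) = v c) ->
  (forall B c, B != fset0 -> [disjoint B & S c]%fset ->
    delta (B `|` S c)%fset <= delta B + v c) ->
  uniq l -> (forall c, c \in l -> [disjoint B & S c]%fset) ->
  (forall c c', c \in l -> c' \in l -> c != c' -> [disjoint S c & S c']%fset) ->
  exists2 U : {fset G}, (forall x, x \in U <-> x \in B \/ exists2 c, c \in l & x \in S c) &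
    delta0 U <= delta0 B + \sum_(c <- l) v c.
Proof.
move=> S0 Sv Sub; elim: l => [|c l ih] /=.
  move=> _ _ _; exists B; last by rewrite big_nil addr0.
  by move=> x; split=> [|[//|[c]]//]; left.
move=> /andP[cl ul] Bl ll; have [||U UE Ule] := ih ul.
- by move=> c' c'l; apply: Bl; rewrite inE c'l orbT.
- by move=> c1 c2 h1 h2; apply: ll; rewrite inE ?h1 ?h2 orbT.
exists (U `|` S c)%fset.
  move=> x; rewrite in_fsetU; split.
    case/orP => [/UE[xB|[c' c'l xc']]|xc]; first by left.
      by right; exists c' => //; rewrite inE c'l orbT.
    by right; exists c => //; rewrite inE eqxx.
  case=> [xB|[c']]; first by apply/orP; left; apply/UE; left.
  rewrite inE => /orP[/eqP -> ->|c'l xc']; first by rewrite orbT.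
  by apply/orP; left; apply/UE; right; exists c'.
rewrite big_cons [X in _ + X]addrC addrA.
have Uc : [disjoint U & S c]%fset.
  apply/fdisjointP => x /UE[xB|[c' c'l xc']].
    by have /fdisjointP := Bl c (mem_head _ _); apply.
  have c'c : c' != c by apply: contraNneq cl => <-.
  have c'cl : c' \in c :: l by rewrite inE c'l orbT.
  by have /fdisjointP := ll c' c c'cl (mem_head _ _) c'c; apply.
apply: le_trans (lerD Ule (lexx _)).
rewrite /delta0 fsetU_eq0 (negbTE (S0 c)) andbF.
have [->|U0] := eqVneq U fset0; first by rewrite fset0U Sv add0r.
exact: Sub.
Qed.

(** Every [c] is to be a centre for exactly one [h] in [A]: writing [c = h c0] with [c0] in [C] is
    the same as [c] lying in the tile [A c0], so the [h]-th tiling must have the centres [h c0]. Its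
    tiles [A h c0] form a partition because commutativity turns them into the translates [A c0 h] of
    the given tiles. Summing over [h] then counts each [phi c] once, and the points left over at
    most [#|A|] times. *)
Lemma tiling_bound H : H != fset0 ->
  #|` A|%:R * delta H <= \sum_(c <- H) phi c + \sum_(c <- exits A H) `|phi c| +
    #|` A|%:R * \sum_(c <- exits A H) `|psi c|.
Proof.
move=> H0; have [C [_ [Ccov Ctriv _]]] := A_tiles.
have inA h c : (c \in rtranslate A h) = ((c * h^-1)%g \in A) by exact: in_rtranslate.
have cov g : exists2 c, C c & (g * c^-1)%g \in A.
  have [] : cover C (fun c => [set` rtranslate A c]) g by rewrite Ccov.
  by move=> c Cc; rewrite /= inA; exists c.
have triv g c c' : C c -> C c' -> (g * c^-1)%g \in A -> (g * c'^-1)%g \in A -> c = c'.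
  move=> Cc Cc' gc gc'; apply: (Ctriv c c') => //; exists g; split=> /=; by rewrite inA.
pose Ch h c := `[< C (h^-1 * c)%g >].
pose inside c := all (fun a => (a * c)%g \in H) A.
pose exit g := has (fun f => has (fun f' => (f' * f^-1 * g)%g \notin H) A) A.
have insideH c : inside c -> c \in H.
  by move=> /allP/(_ 1%g A1); rewrite mul1g.
have exitE (v : G -> R) : \sum_(g <- exits A H) `|v g| = \sum_(g <- H | exit g) `|v g|.
  by rewrite [RHS]sum_fset_filter.
have shiftA (g h c0 : G) : (g * (h * c0)^-1)%g = (g * h^-1 * c0^-1)%g.
  by rewrite invgM (G_abelian c0^-1%g) mulgA.
(* For one tiling: [U1] collects the tiles contained in [H], and the rest of [H] is added point by
   point. *)
have step h : h \in A -> delta H <=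
    \sum_(c <- H | Ch h c && inside c) phi c + \sum_(g <- exits A H) `|psi g|.
  move=> hA; have ChE c : Ch h c -> exists2 c0, C c0 & c = (h * c0)%g.
    by move=> /asboolP Cc; exists (h^-1 * c)%g => //; rewrite mulVKg.
  have [|||c c'|U1 U1E U1le] := @delta_big (rtranslate A) phi
      [seq c <- H | Ch h c && inside c] fset0 _ deltaA delta_subA.
  - by move=> c; exact: rtranslate_neq0.
  - exact: filter_uniq (fset_uniq _).
  - by move=> c _; exact: fdisjoint0X.
  - rewrite !mem_filter => /andP[/andP[/ChE[c0 Cc0 ->] _] _].
    move=> /andP[/andP[/ChE[c1 Cc1 ->] _] _]; apply: contraNT => /fdisjointP dis.
    apply/eqP; congr (_ * _)%g; apply: contrapT => c01; apply: dis => x.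
    rewrite !inA !shiftA => xc0; apply/negP => xc1.
    exact: c01 (triv _ _ _ Cc0 Cc1 xc0 xc1).
  have U1H x : x \in U1 -> x \in H.
    move=> /U1E[|[c]]; first by rewrite in_fset0.
    rewrite mem_filter inA => /andP[/andP[_ /allP inc] _] /inc.
    by rewrite mulgVK.
  have [|||c c'|U2 U2E U2le] := @delta_big (fun c => [fset c]%fset) psi
      [seq g <- H | g \notin U1] U1 _ delta1 delta_sub1.
  - by move=> c; apply/fset0Pn; exists c; rewrite inE.
  - exact: filter_uniq (fset_uniq _).
  - by move=> c; rewrite mem_filter fdisjointX1 => /andP[].
  - by move=> _ _ cc'; rewrite fdisjointX1 inE eq_sym.
  have U2H : U2 = H.
    apply/fsetP => x; apply/idP/idP => [/U2E[/U1H//|[c]]|xH].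
      by rewrite mem_filter inE => /andP[_ cH] /eqP ->.
    apply/U2E; have [xU|xU] := boolP (x \in U1); first by left.
    by right; exists x; rewrite ?inE// mem_filter xU.
  move: U2le; rewrite U2H /delta0 (negbTE H0) => /le_trans; apply; apply: lerD.
    apply: le_trans U1le _; rewrite {1}/delta0 eqxx add0r.
    by rewrite big_filter.
  rewrite exitE big_filter [X in X <= _]big_seq_cond [X in _ <= X]big_mkcond/=.
  rewrite [X in X <= _]big_mkcond [X in _ <= X]big_seq [X in X <= _]big_seq.
  apply: ler_sum => g gH; rewrite gH /=; case: ifP => [gU|_]; last by case: ifP.
  suff -> : exit g by exact: ler_norm.
  (* A point not in [U1] lies in a tile [A c] that leaves [H] at some [f' c]; hence it is an exit,
     with [f = g c^-1]. *)
  have [c0 Cc0 gA] := cov (g * h^-1)%g; rewrite -shiftA in gA.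
  set c := (h * c0)%g in gA.
  have Cc : Ch h c by apply/asboolP; rewrite /c mulKg.
  have : ~~ inside c.
    apply: contra gU => inc; apply/U1E; right; exists c; rewrite ?inA//.
    by rewrite mem_filter Cc inc insideH.
  rewrite -has_predC => /hasP[f' f'A /= out].
  apply/hasP; exists (g * c^-1)%g => //; apply/hasP; exists f' => //.
  by rewrite invgM invgK -!mulgA mulVg mulg1.
have : \sum_(h <- A) delta H <= \sum_(h <- A)
    (\sum_(c <- H | Ch h c && inside c) phi c + \sum_(g <- exits A H) `|psi g|).
  by rewrite big_seq [X in _ <= X]big_seq; apply: ler_sum => h hA; exact: step.
rewrite big_split/= [X in X <= _]big_const_seq [X in _ + X]big_const_seq.
rewrite !count_predT !iter_addr_0 -(mulr_natl (delta H)).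
rewrite -(mulr_natl (\sum_(g <- exits A H) `|psi g|)).
move/le_trans; apply; rewrite lerD2r.
under eq_bigr do rewrite big_mkcond/=.
rewrite exchange_big/= exitE [X in _ + X]big_mkcond -big_split/=.
rewrite big_seq [X in _ <= X]big_seq; apply: ler_sum => c cH.
(* A centre whose tile leaves [H] contributes nothing on the left, and it is an exit with [f = 1];
   on the right, [|phi c|] compensates for a negative [phi c]. *)
have [inc|ninc] := boolP (inside c); last first.
  rewrite big1 => [|h _]; last by rewrite andbF.
  have -> : exit c.
    apply/hasP; exists 1%g => //; move: ninc; rewrite -has_predC => /hasP[f' f'A out].
    by apply/hasP; exists f' => //; rewrite invg1 mulg1.
  by rewrite -lerBlDl sub0r -normrN ler_norm.
have [c0 Cc0 cA] := cov c.
rewrite (bigD1_seq _ cA (fset_uniq A))/=.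
have -> : Ch (c * c0^-1)%g c by apply/asboolP; rewrite invgM invgK mulgVK.
rewrite big_seq_cond big1 => [|h /andP[hA hc]].
  by rewrite addr0 lerDl; case: ifP.
case: ifP => // /andP[/asboolP Ch0 _]; exfalso; move/eqP: hc; apply.
have h1 : (c * (h^-1 * c)^-1)%g = h by rewrite invgM invgK mulgA mulgV mul1g.
have <- : (h^-1 * c)%g = c0 by apply: (triv c) => //; rewrite h1.
by rewrite h1.
Qed.

End tiling_bound.

(** * Invariance of the limit and comparison of averages *)

Lemma limn_esup_le_lim (R : realType) (u v : nat -> \bar R) (l : \bar R) :
  (forall n, (u n <= v n)%E) -> v @ \oo --> l -> (limn_esup u <= l)%E.
Proof.
move=> uv vl; have vcv : cvgn v by apply/cvg_ex; exists l.
rewrite -(cvg_lim _ vl)// -(is_cvg_limn_esupE vcv) !limn_esup_lim.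
apply: lee_lim; [exact: is_cvg_esups|exact: is_cvg_esups|].
apply: nearW => n; apply: ub_ereal_sup => _ [k /= nk <-].
by apply: (le_trans (uv k)); apply: ereal_sup_ubound; exists k.
Qed.

Lemma cvg_infty_homo (s : nat -> nat) : {homo s : i j / (i < j)%N} ->
  s @ \oo --> \oo.
Proof.
move=> hs; have js j : (j <= s j)%N.
  by elim: j => // j ih; exact: leq_ltn_trans ih (hs _ _ (ltnSn j)).
move=> V [n _ nV]; exists n => // j /= nj; apply: nV => /=.
exact: leq_trans (js j).
Qed.

Section conclusion.
Context (R : realType) (G : groupType) d (Om : measurableType d).
Context (P : probability Om R) (T : mp_action G P) (X : pmetricType R).
Variable F : bundle_rds T X.
Local Notation E := (bundle F).
Local Notation skew := Defs.skew.
Local Notation fmap := Defs.fmap.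
Local Notation Y := (Om * borel X)%type.
Implicit Types (nu mu : probability Y R) (f : Y -> R) (k : Om -> R).

Let mE : measurable E := measurable_bundle F.

Lemma dominatedD f g k l : dominated F f k -> dominated F g l ->
  dominated F (fun z => f z + g z) (fun w => k w + l w).
Proof.
move=> [mf ik k0 fk] [mg il l0 gl]; split.
- exact: measurable_funD.
- by have := integrableD measurableT ik il.
- by move=> w; rewrite addr_ge0.
apply: filterS2 fk gl => w fk gl x Ex.
by rewrite (le_trans (ler_normD _ _))// lerD ?fk ?gl.
Qed.

Lemma dominatedZ r f k : 0 <= r -> dominated F f k ->
  dominated F (fun z => r * f z) (fun w => r * k w).
Proof.
move=> r0 [mf ik k0 fk]; split.
- by apply: measurable_funM => //; exact: measurable_cst.
- by have := integrableZl measurableT r ik.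
- by move=> w; rewrite mulr_ge0.
apply: filterS fk => w fk x Ex.
by rewrite normrM ger0_norm// ler_wpM2l// fk.
Qed.

Lemma dominated0 : dominated F (fun=> 0) (fun=> 0).
Proof.
split=> //; [exact: integrable0|apply: aeW => w x _; by rewrite normr0].
Qed.

Lemma dominated_sum (l : seq G) (f : G -> Y -> R) (k : G -> Om -> R) :
  (forall c, dominated F (f c) (k c)) ->
  dominated F (fun z => \sum_(c <- l) f c z) (fun w => \sum_(c <- l) k c w).
Proof.
move=> fk; elim: l => [|c l ih].
  rewrite (_ : (fun z => _) = fun=> 0); last by apply/funext => z; rewrite big_nil.
  rewrite (_ : (fun w => _) = fun=> 0); last by apply/funext => w; rewrite big_nil.
  exact: dominated0.
rewrite (_ : (fun z => _) = fun z => f c z + \sum_(c <- l) f c z); last first.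
  by apply/funext => z; rewrite big_cons.
rewrite (_ : (fun w => _) = fun w => k c w + \sum_(c <- l) k c w); last first.
  by apply/funext => w; rewrite big_cons.
exact: dominatedD.
Qed.

Lemma Rintegral_dominated_sum nu (l : seq G) (f : G -> Y -> R) (k : G -> Om -> R) :
  marginal P nu -> (forall c, dominated F (f c) (k c)) ->
  \int[nu]_(z in E) \sum_(c <- l) f c z = \sum_(c <- l) \int[nu]_(z in E) f c z.
Proof.
move=> nuP fk; elim: l => [|c l ih].
  rewrite big_nil; under eq_Rintegral do rewrite big_nil.
  by rewrite Rintegral_cst// mul0r.
rewrite big_cons -ih; under eq_Rintegral do rewrite big_cons.
rewrite RintegralD//; first exact: dominated_integrable nuP (fk c).
exact: dominated_integrable nuP (dominated_sum l fk).
Qed.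

Lemma Rintegral_act g k : P.-integrable setT (EFin \o k) -> (forall w, 0 <= k w) ->
  \int[P]_w k (T g w) = \int[P]_w k w.
Proof.
move=> ik k0; congr fine; apply: (integral_act T g (k := EFin \o k)).
  exact: measurable_int ik.
by move=> w; rewrite lee_fin.
Qed.

Lemma test_Rintegral (m : probability Y R) (A : set Om) (h : X -> R) :
  m E = 1%E -> measurable A -> compact [set: X] -> continuous h ->
  \int[m]_(z in fst @^-1` A) h z.2 =
  \int[m]_(z in E) ((fun z : Y => h z.2) \_ (fst @^-1` A)) z.
Proof.
move=> m1 mA cX ch; have mfA := @measurable_fst_preimage _ _ _ (borel X) _ mA.
have [M hM] := continuous_bounded cX ch.
have mCE : measurable (~` E) by exact: measurableC.
have mCE0 : m (~` E) = 0%E by rewrite probability_setC// m1 subee.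
rewrite Rintegral_mkcond /Rintegral.
rewrite (@negligible_integral _ _ _ m setT (~` E))//; first by rewrite setTD setCK.
apply: measurable_bounded_integrable => //.
- exact: le_lt_trans (probability_le1 m measurableT) (ltry _).
- apply/(measurable_restrictT _ mfA); apply: measurable_funTS.
  by apply: measurableT_comp measurable_snd; exact: continuous_borel_measurable.
exists M; split; first exact: num_real.
move=> N /ltW MN z _ /=; apply: le_trans MN; rewrite patchE.
by case: ifP => _ //; rewrite normr0 (le_trans _ (hM z.2)).
Qed.

Lemma test_dominated (A : set Om) (h : X -> R) : measurable A ->
  compact [set: X] -> continuous h -> exists M : R,
  dominated F ((fun z : Y => h z.2) \_ (fst @^-1` A)) (fun=> M) /\
  fibre_continuous F ((fun z : Y => h z.2) \_ (fst @^-1` A)).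
Proof.
move=> mA cX ch; have mfA := @measurable_fst_preimage _ _ _ (borel X) _ mA.
have [M hM] := continuous_bounded cX ch; exists M; split; [split|].
- apply: measurable_funTS; apply/(measurable_restrictT _ mfA).
  apply: measurable_funTS.
  by apply: measurableT_comp measurable_snd; exact: continuous_borel_measurable.
- exact: finite_measure_integrable_cst.
- by move=> _; exact: le_trans (normr_ge0 _) (hM point).
- apply: aeW => w x _; rewrite patchE.
  by case: ifP => _ //; rewrite normr0 (le_trans _ (hM point)).
apply: aeW => w; apply: continuous_subspaceT.
have [Aw|nAw] := pselect (A w).
  suff -> : (fun x : X => ((fun z : Y => h z.2) \_ (fst @^-1` A)) (w, x)) = h by [].
  by apply/funext => x; rewrite patchE mem_set.
suff -> : (fun x : X => ((fun z : Y => h z.2) \_ (fst @^-1` A)) (w, x)) = cst 0.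
  by move=> x; exact: cvg_cst.
by apply/funext => x; rewrite patchE memNset.
Qed.

Lemma Rintegral_act_prob g nu f k : marginal P nu -> dominated F f k ->
  \int[act_prob F g nu]_(z in E) f z = \int[nu]_(z in E) f (skew F g z).
Proof.
move=> nuP df; have g0 : [fset g]%fset != fset0 by apply/fset0Pn; exists g; rewrite inE.
have := Rintegral_average g0 nuP df.
rewrite cardfs1 invr1 mul1r big_seq_fset1 => <-.
congr fine; apply: eq_measure_integral => B mB _.
by rewrite /= /average cardfs1 invr1 mul1e big_seq_fset1.
Qed.

(** Composing with [g] turns the sum over [A] into the sum over [g A], so only the symmetric
    difference contributes, and each term is at most the integral of [k] because the action
    preserves [P]. *)
Lemma Rintegral_average_skew (A : {fset G}) (A0 : A != fset0) g nu f k :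
  marginal P nu -> dominated F f k ->
  `|\int[average F nu A0]_(z in E) f (skew F g z) -
    \int[average F nu A0]_(z in E) f z| <=
  (\int[P]_w k w) * (#|` symdiff (ltranslate g A) A|%:R / #|` A|%:R).
Proof.
move=> nuP df.
rewrite (Rintegral_average A0 nuP (dominated_skew g df)).
rewrite (Rintegral_average A0 nuP df) -mulrBr.
pose a h := \int[nu]_(z in E) f (skew F h z).
have -> : \sum_(h <- A) \int[nu]_(z in E) (f \o skew F g) (skew F h z) =
    \sum_(h <- ltranslate g A) a h.
  rewrite sum_ltranslate; apply: eq_bigr => h _; apply: eq_Rintegral => z /set_mem Ez.
  by rewrite /= skewM.
have aM h : `|a h| <= \int[P]_w k w.
  have := dominated_Rintegral_le nuP (dominated_skew h df).
  by case: df => _ ik k0 _; rewrite Rintegral_act.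
rewrite normrM ger0_norm ?invr_ge0// mulrA mulrC ler_pM2r.
  exact: sum_symdiff_le.
by rewrite invr_gt0 ltr0n cardfs_gt0.
Qed.

Section limit_invariant.
Variable Fn : folner_seq R G.
Variables (nu_ : nat -> probability Y R) (s : nat -> nat) (mu : probability Y R).
Hypothesis nu_b : forall j, prob_bundle F (nu_ j).
Hypothesis mu_b : prob_bundle F mu.
Hypothesis s_homo : {homo s : i j / (i < j)%N}.
Hypothesis avg_cvg : forall f k, dominated F f k -> fibre_continuous F f ->
  (fun j => \int[average F (nu_ j) (folner_neq0 Fn (s j))]_(z in E) f z) @ \oo -->
  \int[mu]_(z in E) f z.

(** It is enough to compare integrals of products of an indicator on the base and a continuous
    function on [X]. Composition with [skew] destroys the product form, which is why [avg_cvg] is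
    needed for all dominated functions continuous on fibres. *)
Lemma limit_invariant : compact [set: X] ->
  forall g B, measurable B -> act_prob F g mu B = mu B.
Proof.
move=> cX g; apply: random_measure_unique => A h mA ch.
have [M [df cf]] := test_dominated mA cX ch.
have [actP actE] := act_prob_bundle g mu_b; have [muP muE] := mu_b.
rewrite (test_Rintegral actE mA cX ch) (test_Rintegral muE mA cX ch).
rewrite (Rintegral_act_prob g muP df).
move: df cf; set f := (_ \_ _) => df cf.
have cv := avg_cvg df cf.
have cu := avg_cvg (dominated_skew g df) (fibre_continuous_skew g cf).
apply/eqP; rewrite -subr_eq0; apply/eqP.
apply: (cvg_unique _ (cvgB cu cv)) => //.
have ratio_cvg : (fun j => (\int[P]_w M) *
    (#|` symdiff (ltranslate g (Fn (s j))) (Fn (s j))|%:R / #|` Fn (s j)|%:R)) @ \oo --> 0.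
  rewrite -[X in _ --> X](mulr0 (\int[P]_w M)); apply: cvgM; first exact: cvg_cst.
  exact: (cvg_comp _ _ (cvg_infty_homo s_homo) (folner_cvg Fn g)).
apply/cvgrPdist_le => e e0; move/cvgrPdist_le: ratio_cvg => /(_ e e0).
apply: filterS => j; rewrite !sub0r !normrN => ratio_e.
apply: le_trans (le_trans (ler_norm _) ratio_e).
exact: Rintegral_average_skew (prob_bundle_marginal (nu_b j)) df.
Qed.

End limit_invariant.

(** * The tiling bound in integrated form *)

Section family.
Variables (Fn : folner_seq R G) (D : {fset G} -> Y -> R).
Hypothesis D_L1 : forall A : {fset G}, A != fset0 -> L1_bundle F (D A).
Hypothesis D_subadditive : subadditive_family F D.
Hypothesis D_invariant : invariant_family F D.
Hypothesis G_abelian : forall g h : G, commute g h.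

Lemma folner1_in n : 1%g \in Fn n.
Proof.
elim: n => [|n ih]; first exact: folner1.
exact: (fsubsetP (fproper_sub (folner_proper Fn n))).
Qed.

Lemma exits_ratio_cvg (A : {fset G}) :
  (fun n => #|` exits A (Fn n)|%:R / #|` Fn n|%:R : R) @ \oo --> (0 : R).
Proof.
have sum_cvg : (fun n => \sum_(f <- A) \sum_(f' <- A)
    (#|` symdiff (ltranslate (f' * f^-1)%g (Fn n)) (Fn n)|%:R / #|` Fn n|%:R : R)) @ \oo --> (0 : R).
  rewrite [X in _ --> X](_ : _ = \sum_(f <- A) \sum_(f' <- A) 0); last first.
    by rewrite big1// => f _; rewrite big1.
  apply: cvg_big => [|f _]; first exact: add_continuous.
  apply: cvg_big => [|f' _]; first exact: add_continuous.
  exact: folner_cvg.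
apply: (squeeze_cvgr _ (cvg_cst 0) sum_cvg); apply: nearW => n.
rewrite divr_ge0//=; under eq_bigr do rewrite -mulr_suml.
rewrite -mulr_suml ler_wpM2r ?invr_ge0//.
under eq_bigr do rewrite -natr_sum.
by rewrite -natr_sum ler_nat; exact: exits_card.
Qed.

Lemma family_averageE (A : {fset G}) nu : A != fset0 -> marginal P nu ->
  family_average F D A nu = (#|` A|%:R^-1 * \int[nu]_(z in E) D A z)%:E.
Proof.
move=> A0 nuP; have [k dk] := L1_bundle_dominated (D_L1 A0).
rewrite /family_average EFinM /Rintegral fineK//.
exact: integrable_fin_num (dominated_integrable nuP dk).
Qed.

(** Integrated against [nu], the sum of [D A] over the translates by [H] becomes [#|H|] times the
    integral of [D A] against the average of [nu] over [H]. Since [K] depends neither on [H] nor on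
    [nu], only the proportion of exits governs the error. *)
Lemma family_average_bound (A : {fset G}) : 1%g \in A -> tiles A ->
  exists K : R, forall (H : {fset G}) (H0 : H != fset0) nu, marginal P nu ->
    #|` H|%:R^-1 * \int[nu]_(z in E) D H z <=
    #|` A|%:R^-1 * \int[average F nu H0]_(z in E) D A z +
    K * (#|` exits A H|%:R / #|` H|%:R).
Proof.
move=> A1 tA; have A0 : A != fset0 by apply/fset0Pn; exists 1%g.
have u0 : [fset 1%g]%fset != fset0 :> {fset G} by apply/fset0Pn; exists 1%g; rewrite inE.
have [k dk] := L1_bundle_dominated (D_L1 A0).
have [l dl] := L1_bundle_dominated (D_L1 u0).
have cA : 0 < #|` A|%:R :> R by rewrite ltr0n cardfs_gt0.
(* Each exit costs at most the integral of the bound [k] of [D A], and [#|A|] times that of the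
   bound [l] of [D] at the singleton of 1, to which invariance reduces all singletons. *)
exists (#|` A|%:R^-1 * (\int[P]_w k w + #|` A|%:R * \int[P]_w l w)) => H H0 nu nuP.
have cH : 0 < #|` H|%:R :> R by rewrite ltr0n cardfs_gt0.
have [kH dH] := L1_bundle_dominated (D_L1 H0).
have dphi c := dominated_skew c dk; have dpsi c := dominated_skew c dl.
have nphi c := dominated_norm (dphi c); have npsi c := dominated_norm (dpsi c).
have := dominated_le_Rintegral nuP (dominatedZ (ltW cA) dH)
  (dominatedD (dominatedD (dominated_sum H dphi) (dominated_sum (exits A H) nphi))
    (dominatedZ (ltW cA) (dominated_sum (exits A H) npsi))).
have ptwise : {ae P, forall w x, E (w, x) -> #|` A|%:R * D H (w, x) <=
    \sum_(c <- H) D A (skew F c (w, x)) +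
    \sum_(c <- exits A H) `|D A (skew F c (w, x))| +
    #|` A|%:R * \sum_(c <- exits A H) `|D [fset 1%g]%fset (skew F c (w, x))|}.
  apply: filterS2 D_subadditive D_invariant => w Dsub Dinv x Ex.
  have D1 c : D [fset c]%fset (w, x) = D [fset 1%g]%fset (skew F c (w, x)).
    by rewrite -rtranslate1 Dinv.
  apply: (tiling_bound G_abelian (delta := fun B => D B (w, x))
    (phi := fun c => D A (skew F c (w, x)))
    (psi := fun c => D [fset 1%g]%fset (skew F c (w, x)))) => //.
  - by move=> c; exact: Dinv.
  - by move=> B c B0 dis; exact: Dsub.
  - by move=> B c B0 dis; rewrite -(rtranslate1 c); apply: Dsub; rewrite ?rtranslate1.
move=> /(_ ptwise).
have iA : nu.-integrable E (EFin \o D H) by exact: dominated_integrable nuP dH.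
have i1 := dominated_integrable nuP (dominated_sum H dphi).
have i2 := dominated_integrable nuP (dominated_sum (exits A H) nphi).
have i3 := dominated_integrable nuP (dominated_sum (exits A H) npsi).
have i12 := dominated_integrable nuP (dominatedD (dominated_sum H dphi)
  (dominated_sum (exits A H) nphi)).
have i3' := dominated_integrable nuP
  (dominatedZ (ltW cA) (dominated_sum (exits A H) npsi)).
rewrite RintegralZl// RintegralD// RintegralD// RintegralZl//.
rewrite (Rintegral_dominated_sum H nuP dphi).
rewrite (Rintegral_dominated_sum (exits A H) nuP nphi).
rewrite (Rintegral_dominated_sum (exits A H) nuP npsi).
have avgE := Rintegral_average H0 nuP dk.
have exits_le f m : dominated F f m ->
    \sum_(c <- exits A H) \int[nu]_(z in E) `|(f \o skew F c) z| <=
    #|` exits A H|%:R * \int[P]_w m w.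
  move=> dm; apply: (@le_trans _ _ (\sum_(c <- exits A H) \int[P]_w m w)).
    apply: ler_sum => c _; apply: le_trans (ler_norm _) _.
    have := dominated_Rintegral_le nuP (dominated_norm (dominated_skew c dm)).
    by case: dm => _ im m0 _; rewrite Rintegral_act.
  by rewrite big_const_seq count_predT iter_addr_0 mulr_natl.
have b1 := exits_le _ _ dk; have b2 := exits_le _ _ dl.
have -> : \sum_(c <- H) \int[nu]_(z in E) (D A \o skew F c) z =
    #|` H|%:R * \int[average F nu H0]_(z in E) D A z.
  by rewrite avgE mulrA mulfV ?mul1r// gt_eqF.
set q := #|` exits A H|%:R in b1 b2 *; set a := #|` A|%:R in cA b2 *.
set n := #|` H|%:R in cH *; set v := \int[average F nu H0]_(z in E) _.
set u := \int[nu]_(z in E) _ => main.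
have main' : a * u <= n * v + q * (\int[P]_w k w + a * \int[P]_w l w).
  apply: le_trans main _; rewrite -addrA lerD2l mulrDr lerD//.
  by rewrite mulrCA ler_wpM2l// ltW.
rewrite -(ler_pM2l cA) mulrA -(ler_pM2l cH).
have -> : n * (a * n^-1 * u) = a * u by field; rewrite gt_eqF.
apply: le_trans main' _; rewrite le_eqVlt; apply/orP; left; apply/eqP.
by field; rewrite !gt_eqF.
Qed.

End family.

End conclusion.

(** Stated for arbitrary measures and an arbitrary increasing [s] because it is applied twice: to
    the given measures along the subsequence, and to the constant sequence [mu] with [s = id]. *)
Lemma family_limsup_le (R : realType) (G : groupType)
    (Fn : folner_seq R G) d (Om : measurableType d) (P : probability Om R)
    (T : mp_action G P) (X : pmetricType R) (F : bundle_rds T X)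
    (D : {fset G} -> Om * borel X -> R) (m : nat)
    (nu_ : nat -> probability (Om * borel X)%type R) (s : nat -> nat)
    (mu : probability (Om * borel X)%type R) :
  (forall A : {fset G}, A != fset0 -> L1_bundle F (D A)) ->
  subadditive_family F D -> invariant_family F D ->
  (forall g h : G, commute g h) ->
  (forall j, marginal P (nu_ j)) -> marginal P mu ->
  {homo s : i j / (i < j)%N} ->
  (fun j => \int[average F (nu_ j) (folner_neq0 Fn (s j))]_(z in bundle F) D (Fn m) z)
    @ \oo --> \int[mu]_(z in bundle F) D (Fn m) z ->
  (limn_esup (fun j => family_average F D (Fn (s j)) (nu_ j)) <=
   family_average F D (Fn m) mu)%E.
Proof.
move=> D_L1 Dsub Dinv Gab nuP muP s_homo nu_mu.
have [K KP] := family_average_bound D_L1 Dsub Dinv Gab (folner1_in Fn m)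
  (folner_tiles Fn m).
rewrite family_averageE//; last exact: folner_neq0.
pose b j : R := #|` Fn m|%:R^-1 *
  \int[average F (nu_ j) (folner_neq0 Fn (s j))]_(z in bundle F) D (Fn m) z +
  K * (#|` exits (Fn m) (Fn (s j))|%:R / #|` Fn (s j)|%:R).
apply: (@limn_esup_le_lim _ _ (EFin \o b)).
  move=> j; rewrite family_averageE//; last exact: folner_neq0.
  by rewrite lee_fin; exact: KP.
apply: cvg_EFin; first exact: nearW.
rewrite -[X in _ --> X]addr0; apply: cvgD.
  by apply: cvgM; [exact: cvg_cst|exact: nu_mu].
rewrite -[X in _ --> X](mulr0 K); apply: cvgM; first exact: cvg_cst.
exact: (cvg_comp _ _ (cvg_infty_homo s_homo) (exits_ratio_cvg Fn (Fn m))).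
Qed.

Theorem proposition10p4 (R : realType) (G : groupType)
  (G_countable : countable [set: G]) (G_infinite : infinite_set [set: G])
  (Fn : folner_seq R G)
  (d : measure_display) (Om : measurableType d) (P : probability Om R)
  (P_lebesgue : lebesgue_space P) (T : mp_action G P)
  (X : pmetricType R) (X_compact : compact [set: X])
  (F : bundle_rds T X)
  (D : {fset G} -> Om * borel X -> R)
  (D_L1 : forall A : {fset G}, A != fset0 -> L1_bundle F (D A))
  (D_subadditive : subadditive_family F D)
  (D_invariant : invariant_family F D)
  (G_abelian : forall g h : G, commute g h)
  (nu : nat -> probability (Om * borel X)%type R)
  (nu_bundle : forall n, prob_bundle F (nu n)) :
  let mu_ n := average F (nu n) (folner_neq0 Fn n) in
  exists (s : nat -> nat) (mu : probability (Om * borel X)%type R),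
    [/\ {homo s : i j / (i < j)%N},
        prob_bundle F mu /\ bundle_cvg F (fun j => mu_ (s j)) mu,
        inv_prob_bundle F mu &
        (limn_esup (fun j => family_average F D (Fn (s j)) (nu (s j))) <=
         family_mean F D Fn mu)%E].
Proof.
move=> mu_.
have mu_b n : prob_bundle F (mu_ n) by exact: average_prob_bundle.
have mE := measurable_bundle F.
have [s [mu [s_homo muP mu_fib test_cvg]]] := random_measure_compactness
  P_lebesgue X_compact (fun n => prob_bundle_marginal (mu_b n)).
have muE : mu (bundle F) = 1%E.
  apply: (limit_support P_lebesgue X_compact
    (fun j => prob_bundle_marginal (mu_b (s j))) muP test_cvg mE) => [|j].
    apply: filterS (bundle_ae F) => w /= [_ cE _].
    by apply: compact_closed; [exact: metric_hausdorff|exact: cE].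
  by case: (mu_b (s j)).
have mub : prob_bundle F mu by [].
have cvg_dom f k : dominated F f k -> fibre_continuous F f ->
    (fun j => \int[mu_ (s j)]_(z in bundle F) f z) @ \oo -->
    \int[mu]_(z in bundle F) f z.
  move=> [mf ik k0 fk] cf.
  apply: (random_measure_cvg P_lebesgue X_compact
    (fun j => prob_bundle_marginal (mu_b (s j))) muP test_cvg mE _ muE mf ik k0).
    by move=> j; case: (mu_b (s j)).
  apply: filterS2 (bundle_ae F) (filterI fk cf) => w [_ cE _] [fkw cfw].
  by split.
have mu_inv : forall g B, measurable B -> act_prob F g mu B = mu B.
  exact: (limit_invariant (fun j => nu_bundle (s j)) mub s_homo cvg_dom).
exists s, mu; split=> //.
- split=> // f f_L1; have [k df] := L1_bundle_dominated f_L1.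
  have intE m : marginal P m -> (\int[m]_(z in bundle F) (f z)%:E =
      (\int[m]_(z in bundle F) f z)%:E)%E.
    move=> mP; rewrite /Rintegral fineK//.
    exact: integrable_fin_num (dominated_integrable mP df).
  rewrite intE//; rewrite [X in X @ _](_ : _ =
      EFin \o (fun j => \int[mu_ (s j)]_(z in bundle F) f z)); last first.
    by apply/funext => j /=; rewrite intE//; case: (mu_b (s j)).
  apply: cvg_EFin; first exact: nearW.
  exact: cvg_dom df (L1_bundle_fibre_continuous f_L1).
have D_cvg m := L1_bundle_dominated (D_L1 _ (folner_neq0 Fn m)).
have limsup_le m : (limn_esup (fun j => family_average F D (Fn (s j)) (nu (s j))) <=
    family_average F D (Fn m) mu)%E.
  have [k dk] := D_cvg m.
  apply: family_limsup_le => //; first by move=> j; case: (nu_bundle (s j)).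
  apply: (cvg_dom _ _ dk); exact: L1_bundle_fibre_continuous (D_L1 _ (folner_neq0 Fn m)).
have avg_mu n f k : dominated F f k ->
    \int[average F mu (folner_neq0 Fn n)]_(z in bundle F) f z =
    \int[mu]_(z in bundle F) f z.
  move=> df; rewrite (Rintegral_average _ muP df).
  rewrite (eq_bigr (fun=> \int[mu]_(z in bundle F) f z)) => [|g _]; last first.
    rewrite -(Rintegral_act_prob g muP df); congr fine.
    by apply: eq_measure_integral => B mB _; exact: mu_inv.
  rewrite big_const_seq count_predT iter_addr_0 -(mulr_natl (Rintegral _ _ _)).
  by rewrite mulrA mulVf ?mul1r// pnatr_eq0 cardfs_eq0 folner_neq0.
have mean_le m : (limn_esup (fun n => family_average F D (Fn n) mu) <=
    family_average F D (Fn m) mu)%E.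
  have [k dk] := D_cvg m.
  apply: (family_limsup_le (s := id)) => //.
  under eq_fun do rewrite (avg_mu _ _ _ dk).
  exact: cvg_cst.
(* A sequence whose limsup is at most each of its terms converges to that limsup, possibly [-oo];
   this makes [family_mean] a genuine limit. *)
have mean_cvg := limn_esup_le_cvg (lexx _) mean_le.
rewrite /family_mean (cvg_lim _ mean_cvg)//.
have := mean_cvg; set l := limn_esup _ => lcvg.
apply: le_trans (_ : _ <= limn (fun n => family_average F D (Fn n) mu))%E _.
  by apply: lime_ge; [apply/cvg_ex; exists l|exact: nearW].
by rewrite (cvg_lim _ lcvg).
Qed.
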